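(* Let $B$ be a CQG algebra. If $B$ is residually finite-dimensional (RFD) as a $*$-algebra, then the discrete quantum group dual to the compact quantum group corresponding to $B$ is maximal almost periodic.
   Context: All algebras are unital (unless said otherwise) and over $\mathbb{C}$. A CQG algebra is a Hopf $*$-algebra that is the linear span of the matrix coefficients of its finite-dimensional unitary comodules. RFD: a $*$-algebra $B$ is RFD if for every $0\ne b\in B$ there is a $*$-representation $\pi$ of $B$ on a finite-dimensional Hilbert space with $\pi(b)\ne 0$. Discrete dual. Let $B$ be a CQG algebra. As a coalgebra, $B$ is a direct sum of matrix subcoalgebras $B_\alpha$. The full dual $B^*$ is a $*$-algebra with multiplication $(fg)(b)=f(b_1)g(b_2)$ and involution $f^*(b)=\overline{f((Sb)^* )}$, and $B^*=\prod_\alpha B_\alpha^*$, where each $B_\alpha^*$ is a full matrix algebra which is a finite-dimensional $C^*$-algebra under this involution. Let $B^\bullet=\bigoplus_\alpha B_\alpha^*$ (algebraic direct sum), and let $A$ be its universal $C^*$-completion (norm: supremum of the norms over all $*$-representations on Hilbert spaces), i.e. the $c_0$-direct sum of the $B_\alpha^*$. $A$ is the (generally non-unital) function algebra of the discrete quantum group dual to $B$. Its multiplier algebra $M(A)$ is the $C^*$-algebra of bounded families in $\prod_\alpha B_\alpha^*$; the strict topology on $M(A)$ is the one defined by the seminorms $x\mapsto\|xa\|$ and $x\mapsto \|ax\|$, $a\in A$. Quantum Bohr compactification. Let $B^\circ\subseteq B^*$ be the linear span of all matrix coefficients of all $*$-homomorphisms $B\to M_m(\mathbb{C})$, $m\ge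 1$. Then $B^\circ$ is contained in $M(A)$, and it is the CQG algebra underlying the quantum Bohr compactification (in the sense of Sołtan) of the discrete quantum group; the $C^*$-algebra $\mathbb{AP}(A)\subseteq M(A)$ of the quantum Bohr compactification is the norm closure of $B^\circ$ in $M(A)$. The discrete quantum group with function algebra $A$ is called maximal almost periodic if $\mathbb{AP}(A)$ is dense in $M(A)$ with respect to the strict topology. *)

(* Defs.v *)
From HB Require Import structures.
From mathcomp Require Import all_boot all_order all_algebra.
From mathcomp Require Import complex.
From mathcomp Require Import all_classical all_reals all_analysis.
Set Implicit Arguments.
Unset Strict Implicit.
Unset Printing Implicit Defensive.
Import Order.TTheory GRing.Theory Num.Theory.
Local Open Scope classical_set_scope.
Local Open Scope ring_scope.

Definition lspan (K : nzRingType) (V : lmodType K) (X : set V) : set V :=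
  [set v | exists n (c : 'I_n -> K) (x : 'I_n -> V),
     (forall i, X (x i)) /\ v = \sum_i c i *: x i].

(* The finite sequence [:: (x1, y1); ...; (xn, yn)] stands for the tensor
   x1 (x) y1 + ... + xn (x) yn.  By the universal property of the tensor
   product, two sequences stand for the same tensor iff every bilinear map
   takes the same value on them; likewise for triples and trilinear maps. *)
Definition tensor_eq (K : fieldType) (V W : lmodType K)
    (s t : seq (V * W)) : Prop :=
  forall (U : lmodType K) (phi : V -> W -> U),
    (forall v, linear (phi v)) -> (forall w, linear (phi^~ w)) ->
    \sum_(p <- s) phi p.1 p.2 = \sum_(p <- t) phi p.1 p.2.

Definition tensor3_eq (K : fieldType) (V W X : lmodType K)
    (s t : seq (V * W * X)) : Prop :=
  forall (U : lmodType K) (phi : V -> W -> X -> U),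
    (forall v w, linear (phi v w)) ->
    (forall v x, linear (fun w => phi v w x)) ->
    (forall w x, linear (fun v => phi v w x)) ->
    \sum_(p <- s) phi p.1.1 p.1.2 p.2 = \sum_(p <- t) phi p.1.1 p.1.2 p.2.

(* [hcomul b] is a Sweedler representative b_1 (x) b_2 of the comultiplication;
   all axioms constrain it only through the tensor it stands for.  The
   compatibility of the counit and of the antipode with the involution follows
   from these axioms. *)
Record hopfStarAlg (R : realType) := HopfStarAlg {
  hcarrier :> algType R[i];
  hstar : hcarrier -> hcarrier;
  hcomul : hcarrier -> seq (hcarrier * hcarrier);
  hcounit : {lrmorphism hcarrier -> R[i]^o};
  hantipode : {linear hcarrier -> hcarrier};
  hstarK : forall x, hstar (hstar x) = x;
  hstar_antilinear : forall (a : R[i]) x y,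
    hstar (a *: x + y) = a^* *: hstar x + hstar y;
  hstarM : forall x y, hstar (x * y) = hstar y * hstar x;
  hcomul_linear : forall (a : R[i]) x y,
    tensor_eq (hcomul (a *: x + y))
              ([seq (a *: p.1, p.2) | p <- hcomul x] ++ hcomul y);
  hcomul1 : tensor_eq (hcomul 1) [:: (1, 1)];
  hcomulM : forall x y,
    tensor_eq (hcomul (x * y))
      [seq (p.1 * q.1, p.2 * q.2) | p <- hcomul x, q <- hcomul y];
  hcomul_star : forall x,
    tensor_eq (hcomul (hstar x)) [seq (hstar p.1, hstar p.2) | p <- hcomul x];
  hcomulA : forall x,
    tensor3_eq [seq (q.1, q.2, p.2) | p <- hcomul x, q <- hcomul p.1]
               [seq (p.1, q.1, q.2) | p <- hcomul x, q <- hcomul p.2];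
  hcounitl : forall x, \sum_(p <- hcomul x) hcounit p.1 *: p.2 = x;
  hcounitr : forall x, \sum_(p <- hcomul x) hcounit p.2 *: p.1 = x;
  hantipodel : forall x,
    \sum_(p <- hcomul x) hantipode p.1 * p.2 = hcounit x *: 1;
  hantipoder : forall x,
    \sum_(p <- hcomul x) p.1 * hantipode p.2 = hcounit x *: 1
}.

Section QuantumGroup.
Variables (R : realType) (B : hopfStarAlg R).
Local Notation C := R[i].

(* The matrix of a right comodule structure on C^n in the standard basis:
   e_j |-> \sum_i e_i (x) u i j. *)
Definition is_comodule_mx n (u : 'M[B]_n) : Prop :=
  forall i j,
    tensor_eq (hcomul (u i j)) [seq (u i k, u k j) | k <- enum 'I_n] /\
    hcounit B (u i j) = (i == j)%:R.

Definition hadjmx n (u : 'M[B]_n) : 'M[B]_n := \matrix_(i, j) hstar (u j i).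

Definition is_unitary_comodule_mx n (u : 'M[B]_n) : Prop :=
  [/\ is_comodule_mx u, u *m hadjmx u = 1%:M & hadjmx u *m u = 1%:M].

Definition is_CQG : Prop :=
  lspan [set b : B | exists n (u : 'M[B]_n) i j,
    is_unitary_comodule_mx u /\ b = u i j] = setT.

(* *-representations on the Hilbert space C^n; [lrmorphism]s are unital. *)
Definition is_star_rep n (pi : {lrmorphism B -> 'M[C]_n}) : Prop :=
  forall b, pi (hstar b) = \matrix_(i, j) (pi b j i)^*.

Definition is_RFD : Prop :=
  forall b : B, b != 0 ->
  exists n (pi : {lrmorphism B -> 'M[C]_n}), is_star_rep pi /\ pi b != 0.

(* The full dual B^* is the set of f : B -> C with [scalar f]. *)
Definition dmul (f g : B -> C) : B -> C :=
  fun b => \sum_(p <- hcomul b) f p.1 * g p.2.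

Definition dsub (f g : B -> C) : B -> C := fun b => f b - g b.

Definition dstar (f : B -> C) : B -> C :=
  fun b => (f (hstar (hantipode B b)))^*.

(* The subcoalgebras isomorphic to the dual of a full matrix algebra M_n(C).
   These are exactly the summands B_alpha of the coalgebra B, so they serve as
   the index set of the decomposition. *)
Definition is_matrix_subcoalg (D : set B) : Prop :=
  exists n (u : 'M[B]_n),
    [/\ (0 < n)%N, is_comodule_mx u,
        forall c : 'M[C]_n, \sum_i \sum_j c i j *: u i j = 0 -> c = 0 &
        D = lspan [set b : B | exists i j, b = u i j]].

(* D^* is the quotient of B^* by the functionals vanishing on D, so a C^*-norm
   on D^* is a C^*-seminorm on B^* that vanishes exactly on those. *)
Definition is_block_cstar_norm (D : set B) (N : (B -> C) -> R) : Prop :=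
  [/\ forall f, scalar f -> 0 <= N f /\ (N f = 0 <-> forall b, D b -> f b = 0),
      forall (a : C) f, scalar f -> (N (fun b => a * f b))%:C%C = `|a| * (N f)%:C%C,
      forall f g, scalar f -> scalar g -> N (fun b => f b + g b) <= N f + N g,
      forall f g, scalar f -> scalar g -> N (dmul f g) <= N f * N g &
      forall f, scalar f -> N (dmul (dstar f) f) = N f ^+ 2].

(* The C^*-norm of the finite-dimensional C^*-algebra D^*, applied to the
   restriction to D of f in B^*; a C^*-norm on such an algebra exists and is
   unique, so the default value is irrelevant. *)
Definition block_norm (D : set B) : (B -> C) -> R :=
  xget (fun=> 0) [set N | is_block_cstar_norm D N].

(* The norm of the l^oo-direct sum of the blocks, possibly +oo on B^*. *)
Definition mnorm (f : B -> C) : \bar R :=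
  ereal_sup [set (block_norm D f)%:E | D in [set D | is_matrix_subcoalg D]].

(* A, as the c_0-direct sum of the blocks, inside B^* = \prod_alpha B_alpha^*. *)
Definition fun_alg : set (B -> C) :=
  [set a | scalar a /\ forall e : R, 0 < e ->
     finite_set [set D | is_matrix_subcoalg D /\ e <= block_norm D a]].

(* M(A), as the bounded families in B^* = \prod_alpha B_alpha^*. *)
Definition mult_alg : set (B -> C) :=
  [set x | scalar x /\ (mnorm x < +oo)%E].

(* The CQG algebra of the quantum Bohr compactification. *)
Definition bohr_alg : set (B -> C) :=
  [set f | exists n (c : 'I_n -> C) (x : 'I_n -> B -> C),
    (forall k, exists m (pi : {lrmorphism B -> 'M[C]_m}) i j,
       [/\ (0 < m)%N, is_star_rep pi & x k = (fun b => pi b i j)]) /\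
    f = (fun b => \sum_k c k * x k b)].

Definition bohr_cstar_alg : set (B -> C) :=
  [set x | mult_alg x /\ forall e : R, 0 < e ->
     exists y, bohr_alg y /\ (mnorm (dsub x y) < e%:E)%E].

(* Density for the topology given by the seminorms x |-> ||x a||, ||a x||,
   a in A: every basic neighbourhood of every point of M(A) meets X. *)
Definition strictly_dense (X : set (B -> C)) : Prop :=
  forall x, mult_alg x ->
  forall n (a : 'I_n -> B -> C) (e : R), (forall i, fun_alg (a i)) -> 0 < e ->
  exists y, X y /\ forall i,
    (mnorm (dmul (dsub x y) (a i)) < e%:E)%E /\
    (mnorm (dmul (a i) (dsub x y)) < e%:E)%E.

Definition dual_maximal_almost_periodic : Prop := strictly_dense bohr_cstar_alg.

End QuantumGroup.

(* Main.v *)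
(* Matrix coefficients of finite-dimensional *-representations of [B] separate
   points, so they interpolate any functional on finitely many blocks; what has
   to be gained is a bound on the remaining blocks.

   Two points need work.  First, [bohr_alg] is stable under the involution.
   For a *-representation [pi] and a unitary comodule [u], the matrix
   [V' = (pi (u i j)^* )] has the Hilbert-Schmidt norm of the unitary
   [V = (pi (u i j))], and its inverse [W = (pi (S (u i j)^* ))] has bounded
   powers, because the entries of the conjugate comodule are combinations of
   entries of unitary comodules, where the convolution powers of [pi o S] are
   contractions.  Hence [|det V'| >= 1], and by AM-GM [V'] is unitary, that is
   [pi (S b^* ) = pi ((S b)^* )], and [b |-> pi (S b)^T] is a *-representation.

   Second, a coefficient [x] has norm at most 1 in every block [D]: the values
   on a basis of [D] of the powers of [x^* x] are bounded, while the C*-identity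
   gives [N ((x^* x)^(2^k)) = N x ^ (2^(k+1))].

   For a self-adjoint [x] one interpolates it on finitely many blocks by a
   self-adjoint [z] in [bohr_alg], and replaces [z] by the polynomial
   [((1 + i d z / m)^m - 1) / (i d)] with [m] large.  It has norm at most [3 / d]
   in every block, since [(1 - i w)(1 + i w) = 1 + w^2] for self-adjoint [w],
   and differs from [z] by at most [d X^2] in the blocks where the norm of [z]
   is at most [X].  The elements of [fun_alg] are small off finitely many
   blocks. *)
From HB Require Import structures.
Require Import Defs.
From mathcomp Require Import all_boot all_order all_algebra.
From mathcomp Require Import perm complex mxtens.
From mathcomp Require Import all_classical all_reals all_analysis.
From mathcomp Require Import ring lra.
Set Implicit Arguments.
Unset Strict Implicit.
Unset Printing Implicit Defensive.
Import Order.TTheory GRing.Theory Num.Theory.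
Local Open Scope classical_set_scope.
Local Open Scope ring_scope.

(** * Matrices over the complex numbers *)

Section Matrices.
Local Open Scope sesquilinear_scope.
Variable C : numClosedFieldType.

Lemma adjmxM m n p (A : 'M[C]_(m, n)) (B : 'M[C]_(n, p)) :
  (A *m B)^t* = B^t* *m A^t*.
Proof. by rewrite trmx_mul map_mxM. Qed.

Lemma mxtrace_adjM n (A : 'M[C]_n) :
  \tr (A^t* *m A) = \sum_i \sum_j `|A i j| ^+ 2.
Proof.
rewrite exchange_big /=; apply: eq_bigr => i _.
rewrite mxE; apply: eq_bigr => j _.
by rewrite !mxE normCKC.
Qed.

(* [A^* A] has nonnegative eigenvalues with product at least 1 and mean at
   most 1, so all of them are 1 by the equality case of AM-GM. *)
Lemma unitary_of_det_trace n (A : 'M[C]_n) :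
  1 <= `|\det A| -> \tr (A^t* *m A) <= n%:R -> A^t* *m A = 1%:M.
Proof.
move=> detA trA; set H := A^t* *m A.
have Hsym : H^t* = H by rewrite /H adjmxM trmxCK.
have Hnorm : H \is normalmx by apply/normalmxP; rewrite Hsym.
have /orthomx_spectralP Heq := Hnorm.
set P := spectralmx H in Heq; set d := spectral_diag H in Heq.
have Pu : P \is unitarymx := spectral_unitarymx H.
have PP : P *m P^t* = 1%:M by apply/unitarymxP.
have Puni := unitarymx_unit Pu.
have dE : diag_mx d = P *m H *m P^t*.
  by rewrite -(invmx_unitary Pu) [in RHS]Heq !mulmxA mulmxK // mulmxV // mul1mx.
have d_ge0 i : 0 <= d 0 i.
  have -> : d 0 i = (diag_mx d) i i by rewrite mxE eqxx mulr1n.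
  have -> : diag_mx d = (A *m P^t*)^t* *m (A *m P^t*).
    by rewrite dE /H adjmxM trmxCK !mulmxA.
  by rewrite mxE; apply: sumr_ge0 => k _; rewrite !mxE mulrC mul_conjC_ge0.
have det_d : 1 <= \prod_i d 0 i.
  have -> : \prod_i d 0 i = \det H.
    by rewrite -det_diag dE 2!det_mulmx mulrAC -[X in X * _]det_mulmx PP det1 mul1r.
  by rewrite /H det_mulmx det_map_mx det_tr -normCKC exprn_ege1.
have tr_d : \sum_i d 0 i <= n%:R.
  by rewrite -mxtrace_diag dE mxtrace_mulC mulmxA -(invmx_unitary Pu) mulVmx //
    mul1mx.
(* The mean [mu] below divides by [n], so the empty matrix is treated apart. *)
have [n0 | n_gt0] := posnP n.
  by apply/matrixP => i; have := ltn_ord i; rewrite [X in (_ < X)%N]n0.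
have [le_prod eq_prod] := @leif_AGM C 'I_n predT (fun i => d 0 i) (fun i _ => d_ge0 i).
rewrite card_ord /= in le_prod eq_prod.
set mu := (_ / _ : C) in le_prod eq_prod.
have mu_ge0 : 0 <= mu by rewrite mulr_ge0 ?invr_ge0 ?ler0n // sumr_ge0.
have mun_le1 : mu ^+ n <= 1.
  by rewrite exprn_ile1 // ler_pdivrMr ?mul1r // ltr0n.
have prod1 : \prod_i d 0 i = 1.
  by apply/le_anti; rewrite det_d andbT (le_trans le_prod).
have dd i j : d 0 i = d 0 j.
  have : \prod_(i in 'I_n) d 0 i == mu ^+ n by rewrite eq_le le_prod prod1.
  by rewrite eq_prod => /forallP/(_ i)/forallP/(_ j)/eqP.
have d1 i : d 0 i = 1.
  move: prod1; rewrite (eq_bigr (fun=> d 0 i)) => [|j _]; last exact: dd.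
  by rewrite prodr_const card_ord => /eqP; rewrite pexpr_eq1 // => /eqP.
have -> : H = invmx P *m diag_mx d *m P by exact: Heq.
have -> : diag_mx d = 1%:M.
  by apply/matrixP => i j; rewrite !mxE d1.
by rewrite mulmx1 mulVmx.
Qed.

(** The identification of [M_n (M_m C)] with matrices of size [n * m], with [F i j] as blocks. It
    turns the image of a comodule matrix under a representation into one scalar matrix. *)
Definition flatmx n m (F : 'I_n -> 'I_n -> 'M[C]_m) : 'M[C]_(n * m) :=
  \matrix_(a, b) F (mxtens_unindex a).1 (mxtens_unindex b).1
                   (mxtens_unindex a).2 (mxtens_unindex b).2.

Lemma flatmxE n m (F : 'I_n -> 'I_n -> 'M[C]_m) i j k l :
  flatmx F (mxtens_index (i, k)) (mxtens_index (j, l)) = F i j k l.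
Proof. by rewrite mxE !mxtens_indexK. Qed.

Lemma sum_mxtens n m (V : nmodType) (f : 'I_(n * m) -> V) :
  \sum_a f a = \sum_i \sum_k f (mxtens_index (i, k)).
Proof.
rewrite pair_big (reindex (@mxtens_index n m)) /=; last first.
  by exists (@mxtens_unindex n m) => a _; rewrite (mxtens_indexK, mxtens_unindexK).
by apply: eq_bigr => -[i k].
Qed.

Lemma flatmx_mul n m (F G : 'I_n -> 'I_n -> 'M[C]_m) :
  flatmx F *m flatmx G = flatmx (fun i j => \sum_k F i k *m G k j).
Proof.
apply/matrixP => a b; case: (mxtens_indexP a) => i k; case: (mxtens_indexP b) => j l.
rewrite flatmxE mxE sum_mxtens summxE; apply: eq_bigr => p _.
by rewrite mxE; apply: eq_bigr => q _; rewrite !flatmxE.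
Qed.

Lemma flatmx1 n m : flatmx (fun i j : 'I_n => (i == j)%:R *: 1%:M) = 1%:M :> 'M[C]_(n * m).
Proof.
apply/matrixP => a b; case: (mxtens_indexP a) => i k; case: (mxtens_indexP b) => j l.
rewrite flatmxE !mxE (can_eq (@mxtens_indexK n m)) xpair_eqE.
by rewrite -natrM mulnb.
Qed.

Lemma flatmx_adj n m (F : 'I_n -> 'I_n -> 'M[C]_m) :
  (flatmx F)^t* = flatmx (fun i j => (F j i)^t*).
Proof.
apply/matrixP => a b; case: (mxtens_indexP a) => i k; case: (mxtens_indexP b) => j l.
by rewrite flatmxE !mxE !mxtens_indexK.
Qed.

Lemma unitary_entry n (A : 'M[C]_n) i j : A^t* *m A = 1%:M -> `|A i j| <= 1.
Proof.
move=> /matrixP/(_ j j); rewrite !mxE eqxx => A1.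
rewrite -(@expr_le1 _ 2%N) // -[leRHS]A1 (bigD1 i) //= !mxE normCKC lerDl.
by apply: sumr_ge0 => k _; rewrite !mxE mulrC mul_conjC_ge0.
Qed.

(** Operator norm at most 1 for the Euclidean norm, in the squared form that avoids square roots. *)
Definition contractive_mx n (A : 'M[C]_n) :=
  forall v : 'cV[C]_n, \sum_i `|(A *m v) i 0| ^+ 2 <= \sum_i `|v i 0| ^+ 2.

Lemma contractive_mxM n (A B : 'M[C]_n) :
  contractive_mx A -> contractive_mx B -> contractive_mx (A *m B).
Proof. by move=> cA cB v; rewrite -mulmxA; apply: le_trans (cA _) (cB _). Qed.

Lemma contractive_mx_entry n (A : 'M[C]_n) i j : contractive_mx A -> `|A i j| <= 1.
Proof.
move=> /(_ (delta_mx j 0)); rewrite [leRHS](bigD1 j) //= mxE !eqxx normr1 expr1n.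
rewrite [X in _ <= 1 + X]big1 ?addr0 => [|k /negPf kj]; last first.
  by rewrite mxE kj normr0 expr0n.
move=> le1; rewrite -(@expr_le1 _ 2%N) //; apply: le_trans le1.
rewrite (bigD1 i) //= -colE mxE lerDl; apply: sumr_ge0 => k _.
by rewrite exprn_ge0.
Qed.

Lemma unitary_contractive_mx n (A : 'M[C]_n) : A^t* *m A = 1%:M -> contractive_mx A.
Proof.
move=> A1 v.
have sqE (w : 'cV[C]_n) : \sum_i `|w i 0| ^+ 2 = (w^t* *m w) 0 0.
  by rewrite mxE; apply: eq_bigr => i _; rewrite !mxE normCKC.
by rewrite !sqE adjmxM mulmxA -[_ *m A^t* *m A]mulmxA A1 mulmx1.
Qed.

(** The smaller matrix is a compression of [flatmx F]: embed [v] as the vector [w] supported on the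
    inner coordinate [l], apply [flatmx F], and keep the inner coordinate [k]. *)
Lemma flatmx_contractive_mx n m (F : 'I_n -> 'I_n -> 'M[C]_m) k l :
  contractive_mx (flatmx F) -> contractive_mx (\matrix_(i, j) F i j k l).
Proof.
move=> cF v.
pose w : 'cV[C]_(n * m) :=
  \col_a (v (mxtens_unindex a).1 0 * ((mxtens_unindex a).2 == l)%:R).
have wE i p : w (mxtens_index (i, p)) 0 = v i 0 * (p == l)%:R.
  by rewrite mxE mxtens_indexK.
have -> : \sum_i `|v i 0| ^+ 2 = \sum_a `|w a 0| ^+ 2.
  rewrite sum_mxtens; apply: eq_bigr => i _.
  rewrite (bigD1 l) //= wE eqxx mulr1 big1 ?addr0 // => p /negPf pl.
  by rewrite wE pl mulr0 normr0 expr0n.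
apply: le_trans (cF w); rewrite sum_mxtens; apply: ler_sum => i _.
rewrite (bigD1 k) //=; set s := (X in _ <= _ + X).
have -> : (\matrix_(i, j) F i j k l *m v) i 0 = (flatmx F *m w) (mxtens_index (i, k)) 0.
  rewrite !mxE sum_mxtens; apply: eq_bigr => j _.
  rewrite (bigD1 l) //= flatmxE wE eqxx mulr1 mxE big1 ?addr0 // => p /negPf pl.
  by rewrite wE pl !mulr0.
by rewrite lerDl sumr_ge0 // => p _; rewrite exprn_ge0.
Qed.

End Matrices.

(** * Bounded powers of real numbers and of matrices *)

Section RealComplex.
Variable R : realType.
Local Notation C := R[i].

(** If [x > 1], Bernoulli's inequality makes the powers unbounded. Arbitrarily large exponents are
    enough, which allows an application along the exponents [2 ^ k]. *)
Lemma le1_of_bounded_powers (x K : R) : 0 <= x ->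
  (forall k : nat, exists2 n, (k <= n)%N & x ^+ n <= K) -> x <= 1.
Proof.
move=> x_ge0 bnd; rewrite leNgt; apply/negP => x_gt1.
have t_gt0 : 0 < x - 1 by rewrite subr_gt0.
have bernoulli n : 1 + n%:R * (x - 1) <= x ^+ n.
  elim: n => [|n IHn]; first by rewrite mul0r addr0 expr0.
  rewrite exprSr; apply: (@le_trans _ _ ((1 + n%:R * (x - 1)) * x)); last first.
    by rewrite ler_wpM2r.
  have -> : (1 + n%:R * (x - 1)) * x =
    1 + n.+1%:R * (x - 1) + n%:R * (x - 1) ^+ 2 by rewrite -natr1; ring.
  by rewrite lerDl mulr_ge0 // sqr_ge0.
have [n kn xn] := bnd (Num.truncn (K / (x - 1))).+1.
have Kn : K < n%:R * (x - 1).
  rewrite -ltr_pdivrMr //; apply: lt_le_trans (truncnS_gt _) _.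
  by rewrite ler_nat.
have := le_trans (bernoulli n) xn; rewrite leNgt => /negP; apply.
by apply: lt_trans Kn _; rewrite ltrDr ltr01.
Qed.

(** A polynomial substitute for [(1 + t)^m <= exp (m t)]: the bound [1 + s + s^2] with [s = m t]
    goes through by induction, and it is at most 3 for [s <= 1]. *)
Lemma expr1D_le3 (t : R) m : 0 <= t -> m%:R * t <= 1 -> (1 + t) ^+ m <= 3.
Proof.
move=> t0 mt; suff : (1 + t) ^+ m <= 1 + m%:R * t + (m%:R * t) ^+ 2.
  move/le_trans; apply; have : 0 <= m%:R * t by rewrite mulr_ge0.
  by move: mt; move: (m%:R * t) => s; nra.
elim: m mt => [|m IHm]; first by rewrite expr0 => _; nra.
rewrite exprS -natr1; have : 0 <= m%:R :> R by [].
move: IHm; move: (m%:R : R) ((1 + t) ^+ m) => k p IH k0 kt.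
have kt1 : k * t <= 1 by nra.
apply: (@le_trans _ _ ((1 + t) * (1 + k * t + (k * t) ^+ 2))).
  by rewrite ler_wpM2l ?addr_ge0 // IH.
have -> : 1 + (k + 1) * t + ((k + 1) * t) ^+ 2 =
  (1 + t) * (1 + k * t + (k * t) ^+ 2) + t ^+ 2 + k * t ^+ 2 * (1 - k * t) by ring.
by rewrite -[leRHS]addrA lerDl addr_ge0 ?sqr_ge0 // !mulr_ge0 ?sqr_ge0 // subr_ge0.
Qed.

Lemma realc_ge0 (a : C) : 0 <= a -> a = (complex.Re a)%:C%C.
Proof. by move=> a0; rewrite RRe_real // ger0_real. Qed.

Lemma det_entries_le n (A : 'M[C]_n) (c : C) :
  (forall i j, `|A i j| <= c) -> `|\det A| <= #|{perm 'I_n}|%:R * c ^+ n.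
Proof.
move=> Ac; apply: le_trans (ler_norm_sum _ _ _) _.
apply: (@le_trans _ _ (\sum_(s : {perm 'I_n}) c ^+ n)); last by rewrite sumr_const mulr_natl.
apply: ler_sum => s _; rewrite normrM normrX normrN1 expr1n mul1r normr_prod.
by rewrite -[n in c ^+ n]card_ord -prodr_const ler_prod // => i _; rewrite normr_ge0 Ac.
Qed.

(** The number [|det A|^k = |det (A^k)|] stays below the Leibniz bound for every [k]. *)
Lemma det_bounded_powers n (A : 'M[C]_n) (c : C) :
  (forall k i j, `|(A ^+ k) i j| <= c) -> `|\det A| <= 1.
Proof.
move=> Ac; rewrite (realc_ge0 (normr_ge0 (\det A))) (_ : 1 = 1%:C%C) // lecR.
set K := #|{perm 'I_n}|%:R * c ^+ n.
apply: (@le1_of_bounded_powers _ (complex.Re K)).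
  by rewrite -ler0c -realc_ge0.
move=> k; exists k => //.
have detX : \det (A ^+ k) = \det A ^+ k.
  elim: k => [|k IHk]; first by rewrite expr0 det1.
  by rewrite exprS det_mulmx IHk exprS.
have := det_entries_le (Ac k).
rewrite detX normrX -/K => le_K.
have K_ge0 := le_trans (exprn_ge0 k (normr_ge0 (\det A))) le_K.
rewrite -lecR -(realc_ge0 K_ge0).
suff -> : (complex.Re `|\det A| ^+ k)%:C%C = `|\det A| ^+ k by [].
by rewrite [in RHS](realc_ge0 (normr_ge0 (\det A))) rmorphXn.
Qed.
End RealComplex.

(** * Comodules and finite-dimensional *-representations *)

Section HopfStar.
Local Open Scope sesquilinear_scope.
Variables (R : realType) (B : hopfStarAlg R).
Local Notation C := R[i].
Local Notation S := (hantipode B).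
Local Notation eps := (hcounit B).
Implicit Types (x y b : B).

Lemma hstarD x y : hstar (x + y) = hstar x + hstar y.
Proof. by have := hstar_antilinear 1 x y; rewrite conjC1 !scale1r. Qed.

Lemma hstar0 : hstar (0 : B) = 0.
Proof. by apply: (addrI (hstar (0 : B))); rewrite -hstarD !addr0. Qed.

Lemma hstarZ (a : C) x : hstar (a *: x) = a^* *: hstar x.
Proof. by have := hstar_antilinear a x 0; rewrite hstar0 !addr0. Qed.

Lemma hstar_sum I (r : seq I) (F : I -> B) :
  hstar (\sum_(i <- r) F i) = \sum_(i <- r) hstar (F i).
Proof. exact: (big_morph _ hstarD hstar0). Qed.

Lemma hcounitZ (a : C) x : eps (a *: x) = a * eps x.
Proof. exact: linearZ. Qed.

Lemma hcounitP (a : C) x y : eps (a *: x + y) = a * eps x + eps y.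
Proof. exact: linearP. Qed.

Lemma hcounit_star b : eps (hstar b) = (eps b)^*.
Proof.
(* The conjugate of [eps] composed with the involution is again a left counit, and a left counit
   equals the right counit [eps]. *)
have b_conj : b = \sum_(p <- hcomul b) (eps (hstar p.1))^* *: p.2.
  rewrite -{1}[b]hstarK -{1}(hcounitl (hstar b)).
  have := @hcomul_star _ B b B (fun v w => eps v *: w).
  rewrite big_map => -> /=.
    by rewrite hstar_sum; apply: eq_bigr => p _; rewrite hstarZ hstarK.
  - by move=> v a x y; rewrite scalerDr !scalerA mulrC.
  - by move=> w a x y; rewrite hcounitP scalerDl scalerA.
have : eps b = (eps (hstar b))^*.
  rewrite {1}b_conj -{2}(hcounitr b) hstar_sum !raddf_sum /=; apply: eq_bigr => p _.
  by rewrite hstarZ !hcounitZ rmorphM /= conjCK mulrC.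
by move=> ->; rewrite conjCK.
Qed.

Definition bilinear_map (V : lmodType C) (phi : B -> B -> V) :=
  (forall v, linear (phi v)) /\ (forall w, linear (phi^~ w)).

(* Weaker than [is_comodule_mx] in the test spaces allowed, so that stability
   under entrywise adjoints is immediate. *)
Definition weak_comodule_mx n (u : 'M[B]_n) := forall i j,
  (forall m (phi : B -> B -> 'M[C]_m), bilinear_map phi ->
     \sum_(p <- hcomul (u i j)) phi p.1 p.2 = \sum_k phi (u i k) (u k j)) /\
  eps (u i j) = (i == j)%:R.

Lemma comodule_mxE n (u : 'M[B]_n) i j (V : lmodType C) (phi : B -> B -> V) :
  is_comodule_mx u -> bilinear_map phi ->
  \sum_(p <- hcomul (u i j)) phi p.1 p.2 = \sum_k phi (u i k) (u k j).
Proof.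
move=> /(_ i j)[+ _] [phil phir] => /(_ V phi phil phir) ->.
by rewrite big_map big_enum.
Qed.

Lemma comodule_mx_weak n (u : 'M[B]_n) : is_comodule_mx u -> weak_comodule_mx u.
Proof.
move=> cu i j; split; first by move=> m phi; exact: comodule_mxE.
by have [] := cu i j.
Qed.

Lemma comodule_mx_conj n (u : 'M[B]_n) :
  is_comodule_mx u -> weak_comodule_mx (map_mx (@hstar R B) u).
Proof.
move=> cu i j; split=> [m phi [phil phir]|]; last first.
  by rewrite mxE hcounit_star (cu i j).2 conjC_nat.
rewrite mxE; have := @hcomul_star _ B (u i j) _ phi phil phir.
rewrite big_map => ->.
(* Composing [phi] with the involution in both variables gives an antilinear map in each;
   conjugating the entries of its matrix values makes it bilinear again. *)
pose psi v w := map_mx (@Num.conj_op C) (phi (hstar v) (hstar w)).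
have psi_bil : bilinear_map psi.
  by split=> v a x y; rewrite /psi hstarD hstarZ ?phil ?phir;
    apply/matrixP => k l; rewrite !mxE rmorphD rmorphM /= conjCK.
have := comodule_mxE i j cu psi_bil.
move=> /(congr1 (map_mx (@Num.conj_op C))); rewrite !map_mx_sum /psi.
have conjK (A : 'M[C]_m) : map_mx (@Num.conj_op C) (map_mx (@Num.conj_op C) A) = A.
  by rewrite -map_mx_comp (map_mx_id (@conjCK _)).
under eq_bigr do rewrite conjK; move=> ->.
by apply: eq_bigr => k _; rewrite conjK !mxE.
Qed.

(** By the antipode axiom [map_mx S u] is a left inverse of [u], and by unitarity [hadjmx u] is a
    right inverse. *)
Lemma antipode_unitary n (u : 'M[B]_n) i j :
  is_unitary_comodule_mx u -> S (u i j) = hstar (u j i).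
Proof.
case=> cu uu _.
have Su : map_mx S u *m u = 1%:M.
  apply/matrixP => k l; rewrite mxE.
  under eq_bigr do rewrite mxE.
  rewrite -(comodule_mxE k l (phi := fun v w => S v * w) cu).
    by rewrite hantipodel (cu k l).2 !mxE scaler_nat.
  split=> v a x y; first by rewrite mulrDr scalerAr.
  by rewrite linearP mulrDl scalerAl.
have : map_mx S u = hadjmx u by rewrite -[LHS]mulmx1 -uu mulmxA Su mul1mx.
by move=> /matrixP/(_ i j); rewrite !mxE.
Qed.

Lemma CQG_ind (P : B -> Prop) : is_CQG B ->
  P 0 -> (forall a x y, P x -> P y -> P (a *: x + y)) ->
  (forall n (u : 'M[B]_n) i j, is_unitary_comodule_mx u -> P (u i j)) ->
  forall b, P b.
Proof.
move=> cqg P0 PD Pu b; have : [set: B] b by [].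
rewrite -cqg => -[n [c [x [xu ->]]]].
elim: n c x xu => [|n IHn] c x xu; first by rewrite big_ord0.
rewrite big_ord_recl; apply: PD; last by apply: IHn => i; exact: xu.
by have [k [u [i [j [uu ->]]]]] := xu ord0; apply: Pu.
Qed.

End HopfStar.

(** * Antipode and involution commute under finite-dimensional *-representations *)

Section Kac.
Local Open Scope sesquilinear_scope.
Variables (R : realType) (B : hopfStarAlg R).
Hypothesis cqg : is_CQG B.
Local Notation C := R[i].
Local Notation S := (hantipode B).
Local Notation eps := (hcounit B).
Variables (m : nat) (pi : {lrmorphism B -> 'M[C]_m}).
Hypothesis pi_star : is_star_rep pi.

Lemma repM x y : pi (x * y) = pi x *m pi y.
Proof. exact: (rmorphM pi). Qed.

Lemma repZ a x : pi (a *: x) = a *: pi x.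
Proof. exact: linearZ. Qed.

Lemma repP a x y : pi (a *: x + y) = a *: pi x + pi y.
Proof. exact: linearP. Qed.

Lemma rep1 : pi 1 = 1%:M.
Proof. exact: (rmorph1 pi). Qed.

Lemma star_repE b : pi (hstar b) = (pi b)^t*.
Proof. by rewrite pi_star; apply/matrixP => i j; rewrite !mxE. Qed.

Definition coef_mx n (F : B -> 'M[C]_m) (u : 'M[B]_n) := flatmx (fun i j => F (u i j)).

(* The convolution powers of [pi \o S] in the algebra of maps [B -> M_m]. *)
Fixpoint antipode_pow k : B -> 'M[C]_m :=
  if k is k'.+1 then
    fun b => \sum_(p <- hcomul b) pi (S p.1) *m antipode_pow k' p.2
  else fun b => eps b *: 1%:M.

Lemma piS_linear : linear (fun b => pi (S b)).
Proof. by move=> a x y; rewrite !linearP. Qed.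

Lemma conv_bilinear (F G : B -> 'M[C]_m) :
  linear F -> linear G -> bilinear_map (fun v w => F v *m G w).
Proof.
move=> linF linG; split=> v a x y; first by rewrite linG mulmxDr scalemxAr.
by rewrite linF mulmxDl scalemxAl.
Qed.

Lemma antipode_pow_linear k : linear (antipode_pow k).
Proof.
elim: k => [|k IHk] a x y /=; first by rewrite hcounitP scalerDl scalerA.
have [bl br] := conv_bilinear piS_linear IHk.
rewrite (@hcomul_linear _ B a x y _ _ bl br) big_cat big_map /=.
rewrite scaler_sumr; congr (_ + _); apply: eq_bigr => p _.
by rewrite linearZ linearZ /= scalemxAl.
Qed.

(** On a comodule matrix, convolution of maps from [B] to matrices becomes the product of block
    matrices. *)
Lemma coef_antipode_pow n (u : 'M[B]_n) k : weak_comodule_mx u ->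
  coef_mx (antipode_pow k) u = coef_mx (fun b => pi (S b)) u ^+ k.
Proof.
move=> cu; elim: k => [|k IHk].
  rewrite expr0 -[RHS](@flatmx1 C n m) /coef_mx; congr (flatmx _).
  by apply/funext => i; apply/funext => j /=; rewrite (cu i j).2.
rewrite exprS -IHk [RHS]flatmx_mul; congr (flatmx _).
apply/funext => i; apply/funext => j /=.
have [comul _] := cu i j.
exact: (comul _ _ (conv_bilinear piS_linear (antipode_pow_linear k))).
Qed.

Lemma coef_mx_unitary n (u : 'M[B]_n) : is_unitary_comodule_mx u ->
  [/\ (coef_mx pi u)^t* = coef_mx (fun b => pi (S b)) u,
      coef_mx pi u *m (coef_mx pi u)^t* = 1%:M &
      (coef_mx pi u)^t* *m coef_mx pi u = 1%:M].
Proof.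
move=> uu.
have adjE : (coef_mx pi u)^t* = coef_mx (fun b => pi (S b)) u.
  rewrite flatmx_adj; congr (flatmx _); apply/funext => i; apply/funext => j.
  by rewrite (antipode_unitary _ _ uu) star_repE.
have uE : (coef_mx pi u)^t* *m coef_mx pi u = 1%:M.
  rewrite adjE flatmx_mul -flatmx1; congr (flatmx _); apply/funext => i; apply/funext => j.
  have [_ _ /matrixP/(_ i j)] := uu; rewrite !mxE => uu1.
  have := congr1 pi uu1; rewrite raddf_sum rmorph_nat => {uu1} uu1.
  rewrite scaler_nat -[RHS]uu1; apply: eq_bigr => k _.
  by rewrite (antipode_unitary _ _ uu) -repM mxE.
by split=> //; apply: mulmx1C.
Qed.

(** At a coefficient of a unitary comodule the values are entries of powers of a unitary matrix,
    hence at most 1; linear combinations inherit a bound independent of [k]. *)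
Lemma antipode_pow_bounded b :
  exists2 c : C, 0 <= c & forall k i j, `|antipode_pow k b i j| <= c.
Proof.
move: b; apply: (CQG_ind cqg).
- exists 0 => // k i j; suff -> : antipode_pow k 0 = 0 by rewrite mxE normr0.
  by have := antipode_pow_linear k (- 1) 0 0; rewrite scaler0 addr0 scaleN1r addNr.
- move=> a x y [c c0 xc] [d d0 yd]; exists (`|a| * c + d) => [|k i j].
    by rewrite addr_ge0 // mulr_ge0.
  rewrite antipode_pow_linear !mxE; apply: le_trans (ler_normD _ _) _.
  by rewrite lerD // normrM ler_wpM2l.
move=> n u i j uu; exists 1 => // k p q.
have [adjE uV Vu] := coef_mx_unitary uu.
have powV : (coef_mx (antipode_pow k) u)^t* *m coef_mx (antipode_pow k) u = 1%:M.
  rewrite coef_antipode_pow; last by case: uu => /comodule_mx_weak.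
  rewrite -adjE; elim: k => [|k IHk]; first by rewrite expr0 trmx1 map_mx1 mulmx1.
  rewrite exprS adjmxM trmxCK mulmxA -[_ *m coef_mx pi u *m _]mulmxA uV.
  by rewrite mulmx1.
have := unitary_entry (mxtens_index (i, p)) (mxtens_index (j, q)) powV.
by rewrite flatmxE.
Qed.

(* For [V = (pi (u i j))], the matrix [V' = (pi (u i j)^* )] is inverse to
   [W = (pi (S (u i j)^* ))], whose powers are bounded; so [|det V'| >= 1], while
   [V'] has the Hilbert-Schmidt norm of the unitary [V].  Hence [V'] is unitary. *)
Lemma star_rep_antipode_unitary n (u : 'M[B]_n) i j : is_unitary_comodule_mx u ->
  pi (S (hstar (u i j))) = pi (u j i).
Proof.
move=> uu; have [adjE uV Vu] := coef_mx_unitary uu.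
have [cu _ _] := uu; have cu' := comodule_mx_conj cu.
set u' := map_mx _ u in cu'.
pose W := coef_mx (fun b => pi (S b)) u'; pose V' := coef_mx pi u'.
have WV : W *m V' = 1%:M.
  rewrite flatmx_mul -flatmx1; congr (flatmx _).
  apply/funext => k; apply/funext => l; have [comul epsE] := cu' k l.
  pose phi v w := pi (S v * w).
  have phi_bil : bilinear_map phi.
    split=> v a x y; rewrite /phi; first by rewrite mulrDr -scalerAr linearP.
    by rewrite linearP mulrDl -scalerAl linearP.
  have := comul _ _ phi_bil; rewrite /phi -raddf_sum /= hantipodel repZ rep1 epsE.
  by move=> ->; apply: eq_bigr => p _; rewrite repM.
have W_bnd : exists c : C, forall k a b, `|(W ^+ k) a b| <= c.
  have /choice[c c_bnd] : forall ab : 'I_n * 'I_n, exists c : C,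
      0 <= c /\ forall k p q, `|antipode_pow k (u' ab.1 ab.2) p q| <= c.
    by move=> ab; have [c] := antipode_pow_bounded (u' ab.1 ab.2); exists c.
  exists (\sum_ab c ab) => k a b; rewrite -coef_antipode_pow //.
  case: (mxtens_indexP a) => i1 p; case: (mxtens_indexP b) => i2 q; rewrite flatmxE.
  have [_ /(_ k p q)/le_trans] := c_bnd (i1, i2); apply.
  rewrite (bigD1 (i1, i2)) //= lerDl sumr_ge0 // => ab _.
  by have [] := c_bnd ab.
have detV : 1 <= `|\det V'|.
  have [c /det_bounded_powers detW] := W_bnd.
  have := congr1 (fun A => `|\det A|) WV; rewrite det_mulmx det1 normr1 normrM => <-.
  by rewrite ler_piMl.
have trV : \tr (V'^t* *m V') <= (n * m)%:R.
  rewrite -(mxtrace1 C) -Vu !mxtrace_adjM !sum_mxtens le_eqVlt; apply/orP; left; apply/eqP.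
  apply: eq_bigr => i1 _.
  under eq_bigr do rewrite sum_mxtens; under [RHS]eq_bigr do rewrite sum_mxtens.
  rewrite exchange_big [RHS]exchange_big; apply: eq_bigr => i2 _.
  rewrite exchange_big; apply: eq_bigr => p _; apply: eq_bigr => q _.
  by rewrite !flatmxE mxE star_repE !mxE norm_conjC.
have V'u := unitary_of_det_trace detV trV.
(* [W] is a left inverse of the unitary [V'], hence its adjoint; the entries of this identity are
   the claim. *)
have WE : W = V'^t* by rewrite -[W]mulmx1 -(mulmx1C V'u) mulmxA WV mul1mx.
apply/matrixP => p q.
have /matrixP/(_ (mxtens_index (i, p)) (mxtens_index (j, q))) := WE.
by rewrite flatmx_adj !flatmxE -star_repE [u' i j]mxE [u' j i]mxE hstarK.
Qed.

Lemma star_rep_antipode b : pi (S (hstar b)) = pi (hstar (S b)).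
Proof.
move: b; apply: (CQG_ind cqg) => [|a x y IHx IHy|n u i j uu].
- by rewrite hstar0 linear0 hstar0.
- by rewrite hstar_antilinear !(linearP S) hstar_antilinear !repP IHx IHy.
by rewrite (antipode_unitary _ _ uu) hstarK (star_rep_antipode_unitary _ _ uu).
Qed.
End Kac.

(** * The dual algebra *)

Section Dual.
Local Open Scope sesquilinear_scope.
Variables (R : realType) (B : hopfStarAlg R).
Hypothesis cqg : is_CQG B.
Local Notation C := R[i].
Local Notation S := (hantipode B).
Local Notation eps := (hcounit B).
Implicit Types (f g h : B -> C).

(** A single operation for sums and multiples, so that each closure or linearity property takes one
    lemma; a multiple alone is [dcomb a f dzero]. *)
Definition dcomb (a : C) f g : B -> C := fun b => a * f b + g b.
Definition dzero : B -> C := fun=> 0.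

Lemma scalar_dcomb a f g : scalar f -> scalar g -> scalar (dcomb a f g).
Proof. by move=> lf lg c x y; rewrite /dcomb lf lg; ring. Qed.

Lemma scalar_dzero : scalar dzero.
Proof. by move=> c x y; rewrite /dzero mulr0 addr0. Qed.

Lemma scalar_counit : scalar (eps : B -> C).
Proof. by move=> c x y; rewrite hcounitP. Qed.

Lemma functional0 f : scalar f -> f 0 = 0.
Proof. by move=> lf; have := lf (- 1) 0 0; rewrite scaler0 addr0 mulN1r addNr. Qed.

Lemma functionalZ f a x : scalar f -> f (a *: x) = a * f x.
Proof. by move=> lf; have := lf a x 0; rewrite !addr0 (functional0 lf) addr0. Qed.

Lemma functional_sum f I (r : seq I) (F : I -> B) : scalar f ->
  f (\sum_(i <- r) F i) = \sum_(i <- r) f (F i).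
Proof.
move=> lf; apply: (big_morph f); last exact: functional0.
by move=> x y; have := lf 1 x y; rewrite scale1r mul1r.
Qed.

Lemma scalar_ext f g : scalar f -> scalar g ->
  (forall n (u : 'M[B]_n) i j, is_unitary_comodule_mx u -> f (u i j) = g (u i j)) ->
  f = g.
Proof.
move=> lf lg fg; apply/funext; apply: (CQG_ind cqg) => //; first by rewrite !functional0.
by move=> a x y fgx fgy; rewrite lf lg fgx fgy.
Qed.

Lemma dmul_bilinear f g : scalar f -> scalar g ->
  bilinear_map (fun v w => f v * g w : C^o).
Proof.
move=> lf lg; split=> v a x y; first by rewrite lg mulrDr mulrCA.
by rewrite lf mulrDl -mulrA.
Qed.

Lemma scalar_dmul f g : scalar f -> scalar g -> scalar (dmul f g).
Proof.
move=> lf lg a x y; have [bl br] := dmul_bilinear lf lg.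
rewrite /dmul (@hcomul_linear _ B a x y _ _ bl br) big_cat big_map /=.
by rewrite mulr_sumr; congr (_ + _); apply: eq_bigr => p _; rewrite (functionalZ _ _ lf) mulrA.
Qed.

Lemma dmulE f g n (u : 'M[B]_n) i j : is_comodule_mx u -> scalar f -> scalar g ->
  dmul f g (u i j) = \sum_k f (u i k) * g (u k j).
Proof.
by move=> cu lf lg; exact: (comodule_mxE i j cu (dmul_bilinear lf lg)).
Qed.

Lemma dmul_dcombl a f g h : dmul (dcomb a f g) h = dcomb a (dmul f h) (dmul g h).
Proof.
apply/funext => b; rewrite /dmul /dcomb mulr_sumr -big_split /=.
by apply: eq_bigr => p _; rewrite mulrDl mulrA.
Qed.

Lemma dmul_dcombr a f g h : dmul h (dcomb a f g) = dcomb a (dmul h f) (dmul h g).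
Proof.
apply/funext => b; rewrite /dmul /dcomb mulr_sumr -big_split /=.
by apply: eq_bigr => p _; rewrite mulrDr mulrCA.
Qed.

Lemma dmul1l f : scalar f -> dmul eps f = f.
Proof.
move=> lf; apply/funext => b; rewrite -[in RHS](hcounitl b) functional_sum //.
by apply: eq_bigr => p _; rewrite functionalZ.
Qed.

Lemma dmul1r f : scalar f -> dmul f eps = f.
Proof.
move=> lf; apply/funext => b; rewrite -[in RHS](hcounitr b) functional_sum //.
by apply: eq_bigr => p _; rewrite functionalZ // mulrC.
Qed.

Lemma scalar_dstar f : scalar f -> scalar (dstar f).
Proof.
by move=> lf a x y; rewrite /dstar linearP hstar_antilinear lf rmorphD rmorphM /= conjCK.
Qed.

Lemma dstar_dcomb a f g : dstar (dcomb a f g) = dcomb a^* (dstar f) (dstar g).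
Proof. by apply/funext => b; rewrite /dstar /dcomb rmorphD rmorphM. Qed.

(** On the values at a unitary comodule, [dstar] is the conjugate transpose. With [scalar_ext], the
    algebraic laws of [dstar] reduce to those of matrices. *)
Lemma dstarE f n (u : 'M[B]_n) i j : is_unitary_comodule_mx u ->
  dstar f (u i j) = (f (u j i))^*.
Proof. by move=> uu; rewrite /dstar (antipode_unitary _ _ uu) hstarK. Qed.

Lemma dstarK f : scalar f -> dstar (dstar f) = f.
Proof.
move=> lf; apply: scalar_ext => // [|n u i j uu]; first by do 2!apply: scalar_dstar.
by rewrite !dstarE // conjCK.
Qed.

Lemma dstarM f g : scalar f -> scalar g ->
  dstar (dmul f g) = dmul (dstar g) (dstar f).
Proof.
move=> lf lg; have lf' := scalar_dstar lf; have lg' := scalar_dstar lg.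
apply: scalar_ext => [||n u i j uu]; [exact/scalar_dstar/scalar_dmul|exact: scalar_dmul|].
have [cu _ _] := uu; rewrite dstarE // !dmulE // rmorph_sum; apply: eq_bigr => k _.
by rewrite !dstarE // rmorphM mulrC.
Qed.

Lemma dstar_counit : dstar eps = eps :> (B -> C).
Proof.
apply: scalar_ext => [||n u i j uu]; [exact/scalar_dstar/scalar_counit|exact: scalar_counit|].
by have [cu _ _] := uu; rewrite dstarE // (cu i j).2 (cu j i).2 conjC_nat eq_sym.
Qed.

Lemma antipode1 : S 1 = 1.
Proof.
have := hantipodel (1 : B).
have := @hcomul1 _ B B (fun v w => S v * w).
rewrite big_seq1 /= mulr1 => ->; first by rewrite rmorph1 scale1r.
  by move=> v a x y; rewrite mulrDr scalerAr.
by move=> w a x y; rewrite linearP mulrDl scalerAl.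
Qed.

(* For unitary comodules [u], [v], both sides are entries of left inverses of
   the comodule matrix [u (x) v]. *)
Lemma antipodeM x y : S (x * y) = S y * S x.
Proof.
move: x y; apply: (CQG_ind cqg) => [y|a x x' IHx IHx' y|n u i s uu].
- by rewrite mul0r linear0 mulr0.
- by rewrite mulrDl -scalerAl !linearP mulrDr -scalerAr IHx IHx'.
apply: (CQG_ind cqg) => [|a y y' IHy IHy'|n' v k r vv].
- by rewrite mulr0 linear0 mul0r.
- by rewrite mulrDr -scalerAr !linearP mulrDl -scalerAl IHy IHy'.
have [cu uu1 _] := uu; have [cv vv1 _] := vv.
have left_inv p q :
    \sum_j \sum_l S (u i j * v k l) * (u j p * v l q) = ((i == p) && (k == q))%:R.
  have := hantipodel (u i p * v k q).
  pose phi (a b : B) := S a * b.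
  have phil a : linear (phi a) by move=> c x y; rewrite /phi mulrDr scalerAr.
  have phir b : linear (phi^~ b).
    by move=> c x y; rewrite /phi linearP mulrDl scalerAl.
  have := @hcomulM _ B (u i p) (v k q) _ phi phil phir.
  rewrite /phi big_allpairs_dep /= => comulM; rewrite comulM rmorphM /=.
  rewrite (cu i p).2 (cv k q).2 -natrM mulnb scaler_nat => <-.
  have inner (p1 : B * B) : \sum_(p2 <- hcomul (v k q)) S (p1.1 * p2.1) * (p1.2 * p2.2) =
      \sum_l S (p1.1 * v k l) * (p1.2 * v l q).
    apply: (comodule_mxE k q (phi := fun a b => S (p1.1 * a) * (p1.2 * b)) cv).
    split=> w c x y; first by rewrite mulrDr -scalerAr mulrDr -scalerAr.
    by rewrite mulrDr -scalerAr linearP mulrDl scalerAl.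
  under [RHS]eq_bigr do rewrite inner.
  rewrite [RHS]exchange_big [LHS]exchange_big; apply: eq_bigr => l _.
  rewrite -(comodule_mxE i p (phi := fun a b => S (a * v k l) * (b * v l q)) cu) //.
  split=> w c x y; first by rewrite mulrDl -scalerAl mulrDr -scalerAr.
  by rewrite mulrDl -scalerAl linearP mulrDl scalerAl.
have uE j : \sum_p u j p * hstar (u s p) = (j == s)%:R.
  by move/matrixP/(_ j s): uu1; rewrite !mxE => <-; apply: eq_bigr => p _; rewrite mxE.
have vE l : \sum_q v l q * hstar (v r q) = (l == r)%:R.
  by move/matrixP/(_ l r): vv1; rewrite !mxE => <-; apply: eq_bigr => q _; rewrite mxE.
(* An entry of the triple product of the matrix of the [S (u i j * v k l)], the matrix [u (x) v] and
   the adjoint of the latter. Bracketing the first two factors together gives [TE]. *)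
pose T := \sum_p \sum_q (\sum_j \sum_l S (u i j * v k l) * (u j p * v l q)) *
            (hstar (v r q) * hstar (u s p)).
have TE : T = hstar (v r k) * hstar (u s i).
  rewrite /T (bigD1 i) //= (bigD1 k) //= left_inv !eqxx mul1r.
  rewrite !big1 ?addr0 // => [p /negPf pi|q /negPf qk].
    by apply: big1 => q _; rewrite left_inv eq_sym pi mul0r.
  by rewrite left_inv eqxx eq_sym qk mul0r.
rewrite (antipode_unitary _ _ uu) (antipode_unitary _ _ vv) -TE /T.
(* The other bracketing: the last two factors collapse by [vE], then by [uE]. *)
have -> : \sum_p \sum_q (\sum_j \sum_l S (u i j * v k l) * (u j p * v l q)) *
            (hstar (v r q) * hstar (u s p)) =
   \sum_j \sum_l S (u i j * v k l) *
     (\sum_p u j p * (\sum_q v l q * hstar (v r q)) * hstar (u s p)).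
  under eq_bigr do under eq_bigr do rewrite mulr_suml.
  under eq_bigr do rewrite exchange_big.
  rewrite exchange_big; apply: eq_bigr => j _.
  under eq_bigr do under eq_bigr do rewrite mulr_suml.
  under eq_bigr do rewrite exchange_big.
  rewrite exchange_big; apply: eq_bigr => l _.
  rewrite mulr_sumr; apply: eq_bigr => p _.
  rewrite mulr_sumr mulr_suml mulr_sumr; apply: eq_bigr => q _.
  by rewrite !mulrA.
rewrite (bigD1 s) //= (bigD1 r) //= [X in X + _]addrC big1 => [|l /negPf lr]; last first.
  rewrite vE lr; rewrite big1 ?mulr0 // => p _; by rewrite mulr0 mul0r.
rewrite add0r [X in _ + X]big1 ?addr0 => [|j /negPf js]; last first.
  apply: big1 => l _; rewrite vE.
  under eq_bigr do rewrite mulr_natr mulrnAl.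
  by rewrite sumrMnl uE js mul0rn mulr0.
rewrite vE eqxx; under eq_bigr do rewrite mulr1.
by rewrite uE eqxx mulr1.
Qed.

Lemma rep_of_morphism m (F : B -> 'M[C]_m) : linear F -> F 1 = 1%:M ->
  (forall x y, F (x * y) = F x *m F y) ->
  exists pi : {lrmorphism B -> 'M[C]_m}, F = pi.
Proof.
move=> linF F1 FM.
pose L := GRing.isLinear.Build C B 'M[C]_m *:%R F linF.
pose M := GRing.isMonoidMorphism.Build B 'M[C]_m F (F1, FM).
pose FLR : {lrmorphism B -> 'M[C]_m} := HB.pack F L M.
by exists FLR.
Qed.

End Dual.

(** * The *-algebra of coefficients of *-representations, and interpolation by it *)

Section Bohr.
Local Open Scope sesquilinear_scope.
Variables (R : realType) (B : hopfStarAlg R).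
Hypothesis cqg : is_CQG B.
Local Notation C := R[i].
Local Notation S := (hantipode B).
Local Notation eps := (hcounit B).
Implicit Types (f g x y : B -> C).

Definition bohr_coef x := exists m (pi : {lrmorphism B -> 'M[C]_m}) i j,
  [/\ (0 < m)%N, is_star_rep pi & x = (fun b => pi b i j)].

Lemma bohr_coefE m (pi : {lrmorphism B -> 'M[C]_m}) i j :
  is_star_rep pi -> bohr_coef (fun b => pi b i j).
Proof. by move=> pi_star; exists m, pi, i, j; split=> //; apply: leq_trans (ltn_ord i). Qed.

Lemma bohr_ind (P : (B -> C) -> Prop) : P (@dzero R B) ->
  (forall a x y, bohr_coef x -> P y -> P (dcomb a x y)) ->
  forall x, @bohr_alg R B x -> P x.
Proof.
move=> P0 PD x [n [c [z [zcoef ->]]]].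
elim: n c z zcoef => [|n IHn] c z zcoef.
  suff -> : (fun b => \sum_(k < 0) c k * z k b) = @dzero R B by [].
  by apply/funext => b; rewrite big_ord0.
have -> : (fun b => \sum_k c k * z k b) =
    dcomb (c ord0) (z ord0) (fun b => \sum_k c (lift ord0 k) * z (lift ord0 k) b).
  by apply/funext => b; rewrite big_ord_recl.
by apply: PD; [exact: zcoef|apply: IHn => k; exact: zcoef].
Qed.

Lemma bohr_alg_zero : bohr_alg (@dzero R B).
Proof.
exists 0%N, (fun=> 0), (fun=> @dzero R B); split; first by case.
by apply/funext => b; rewrite big_ord0.
Qed.

Lemma bohr_alg_dcomb a x y : bohr_alg x -> bohr_alg y -> bohr_alg (dcomb a x y).
Proof.
move=> [n [c [z [zcoef ->]]]] [n' [c' [z' [z'coef ->]]]].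
exists (n + n')%N.
exists (fun k => match fintype.split k with inl i => a * c i | inr i => c' i end).
exists (fun k => match fintype.split k with inl i => z i | inr i => z' i end).
split=> [k|]; first by case: (fintype.split k).
apply/funext => b; rewrite big_split_ord /dcomb mulr_sumr; congr (_ + _).
  by apply: eq_bigr => k _; rewrite (unsplitK (inl k)) mulrA.
by apply: eq_bigr => k _; rewrite (unsplitK (inr k)).
Qed.

Lemma bohr_alg_sum n (c : 'I_n -> C) (x : 'I_n -> B -> C) :
  (forall i, bohr_alg (x i)) -> bohr_alg (fun b => \sum_i c i * x i b).
Proof.
elim: n c x => [|n IHn] c x bx.
  suff -> : (fun b => \sum_(k < 0) c k * x k b) = @dzero R B by exact: bohr_alg_zero.
  by apply/funext => b; rewrite big_ord0.
suff -> : (fun b => \sum_k c k * x k b) =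
    dcomb (c ord0) (x ord0) (fun b => \sum_k c (lift ord0 k) * x (lift ord0 k) b).
  by apply: bohr_alg_dcomb => //; apply: IHn.
by apply/funext => b; rewrite big_ord_recl.
Qed.

Lemma bohr_alg_coef x : bohr_coef x -> bohr_alg x.
Proof.
move=> xc; exists 1%N, (fun=> 1), (fun=> x); split=> //.
by apply/funext => b; rewrite big_ord1 mul1r.
Qed.

Lemma scalar_bohr_coef x : bohr_coef x -> scalar x.
Proof. by move=> [m [pi [i [j [_ _ ->]]]]] a b c /=; rewrite linearP !mxE. Qed.

Lemma scalar_bohr x : bohr_alg x -> scalar x.
Proof.
move: x; apply: bohr_ind; first exact: scalar_dzero.
by move=> a x y /scalar_bohr_coef; apply: scalar_dcomb.
Qed.

(** The counit is a one-dimensional *-representation. As it is the unit for [dmul], polynomials with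
    constant term stay in [bohr_alg]. *)
Lemma bohr_coef_counit : bohr_coef eps.
Proof.
have [pi piE] : exists pi : {lrmorphism B -> 'M[C]_1}, (fun b => (eps b)%:M) = pi.
  apply: rep_of_morphism => [a b c||b c].
  - by rewrite hcounitP raddfD /= -scale_scalar_mx.
  - by rewrite rmorph1.
  by rewrite rmorphM scalar_mxM.
suff -> : eps = (fun b => pi b ord0 ord0) :> (B -> C).
  apply: bohr_coefE => b; rewrite -piE; apply/matrixP => i j.
  by rewrite !ord1 !mxE hcounit_star.
by rewrite -piE; apply/funext => b; rewrite mxE.
Qed.

(** The product is a coefficient of the tensor product representation, the comultiplication followed
    by [pi] and [rho] on the two legs and the Kronecker product. *)
Lemma bohr_coef_dmul x y : bohr_coef x -> bohr_coef y -> bohr_coef (dmul x y).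
Proof.
move=> [m [pi [i [j [_ pi_star ->]]]]] [n [rho [k [l [_ rho_star ->]]]]].
pose phi v w := pi v *t rho w.
have [phil phir] : bilinear_map phi.
  by split=> v a b c; apply/matrixP => p q; rewrite /phi linearP !mxE; ring.
have [sigma sigmaE] : exists sigma : {lrmorphism B -> 'M[C]_(m * n)},
    (fun b => \sum_(p <- hcomul b) phi p.1 p.2) = sigma.
  apply: rep_of_morphism => [a b c||b c].
  - rewrite (@hcomul_linear _ B a b c _ _ phil phir) big_cat big_map scaler_sumr.
    congr (_ + _); apply: eq_bigr => p _; have := phir p.2 a p.1 0.
    by rewrite !addr0 => -> /=; rewrite /phi linear0 tens0mx addr0.
  - rewrite (@hcomul1 _ B _ _ phil phir) big_seq1 /phi !rep1.
    by apply/matrixP => p q; rewrite !mxE -natrM mulnb -(can_eq (@mxtens_unindexK m n)).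
  rewrite (@hcomulM _ B b c _ _ phil phir) big_allpairs_dep mulmx_suml.
  apply: eq_bigr => p _; rewrite mulmx_sumr; apply: eq_bigr => q _.
  by rewrite /phi tensmx_mul -!repM.
suff -> : dmul (fun b => pi b i j) (fun b => rho b k l) =
    (fun b => sigma b (mxtens_index (i, k)) (mxtens_index (j, l))).
  apply: bohr_coefE => b; rewrite -sigmaE (@hcomul_star _ B b _ _ phil phir) big_map.
  apply/matrixP => p q; rewrite !mxE !summxE rmorph_sum; apply: eq_bigr => r _.
  by rewrite /phi pi_star rho_star !mxE rmorphM.
rewrite -sigmaE; apply/funext => b; rewrite summxE; apply: eq_bigr => p _.
by rewrite tensmxE.
Qed.

Lemma bohr_alg_dmul x y : bohr_alg x -> bohr_alg y -> bohr_alg (dmul x y).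
Proof.
have dmul0l z : dmul (@dzero R B) z = @dzero R B.
  by apply/funext => b; apply: big1 => p _; rewrite mul0r.
have dmul0r z : dmul z (@dzero R B) = @dzero R B.
  by apply/funext => b; apply: big1 => p _; rewrite mulr0.
move=> bx by'; move: x bx; apply: bohr_ind => [|a x z cx IHz].
  by rewrite dmul0l; apply: bohr_alg_zero.
rewrite dmul_dcombl; apply: bohr_alg_dcomb IHz; move: y by'.
apply: bohr_ind => [|c y w cy IHw]; first by rewrite dmul0r; apply: bohr_alg_zero.
by rewrite dmul_dcombr; apply: bohr_alg_dcomb IHw; apply/bohr_alg_coef/bohr_coef_dmul.
Qed.

(** The adjoint is a coefficient of [b |-> pi (S b)^T]: the transpose undoes the
    antimultiplicativity of [S], and [star_rep_antipode] makes the representation involutive. *)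
Lemma bohr_coef_dstar x : bohr_coef x -> bohr_coef (dstar x).
Proof.
move=> [m [pi [i [j [_ pi_star ->]]]]].
have [rho rhoE] : exists rho : {lrmorphism B -> 'M[C]_m}, (fun b => (pi (S b))^T) = rho.
  apply: rep_of_morphism => [a b c||b c].
  - by rewrite !linearP.
  - by rewrite antipode1 rep1 trmx1.
  by rewrite antipodeM // repM trmx_mul.
suff -> : dstar (fun b => pi b i j) = (fun b => rho b i j).
  apply: bohr_coefE => b; rewrite -rhoE star_rep_antipode // pi_star.
  by apply/matrixP => k l; rewrite !mxE.
by rewrite -rhoE; apply/funext => b; rewrite /dstar pi_star !mxE conjCK.
Qed.

Lemma bohr_alg_dstar x : bohr_alg x -> bohr_alg (dstar x).
Proof.
move: x; apply: bohr_ind => [|a x y cx IHy].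
  suff -> : dstar (@dzero R B) = @dzero R B by exact: bohr_alg_zero.
  by apply/funext => b; rewrite /dstar /dzero conjC0.
by rewrite dstar_dcomb; apply: bohr_alg_dcomb IHy; apply/bohr_alg_coef/bohr_coef_dstar.
Qed.

Hypothesis rfd : is_RFD B.

Lemma bohr_separates b : (forall x, bohr_alg x -> x b = 0) -> b = 0.
Proof.
move=> b0; apply/eqP; apply/negPn/negP => /rfd[m [pi [pi_star /eqP]]]; apply.
apply/matrixP => i j; rewrite [RHS]mxE; apply: (b0 (fun b => pi b i j)).
by apply: bohr_alg_coef; apply: bohr_coefE.
Qed.

(* A matrix of maximal rank among those with rows [(x d_1, .., x d_r)], [x] in
   [bohr_alg], has every such row in its row space; its column kernel consists
   of relations between the [d_l], because [bohr_alg] separates points. *)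
Lemma bohr_interpolation r (d : 'I_r -> B) (t : 'rV[C]_r) :
  (forall c : 'cV[C]_r, \sum_l c l 0 *: d l = 0 -> t *m c = 0) ->
  exists2 x, bohr_alg x & forall l, x (d l) = t 0 l.
Proof.
move=> t_rel; pose ev x : 'rV[C]_r := \row_l x (d l).
pose full := [set k : nat | exists n (G : 'I_n -> B -> C),
   (forall i, bohr_alg (G i)) /\ \rank (\matrix_i ev (G i)) = k].
have full_ub k : full k -> (k <= r)%N by move=> [n [G [_ <-]]]; apply: rank_leq_col.
have [k k_full k_max] : exists2 k, full k & forall k', full k' -> (k' <= k)%N.
  have [||k /asboolP fk kmax] := @ex_maxnP (fun k => `[< full k >]) r.
  - exists 0%N; apply/asboolP; exists 0%N, (fun=> @dzero R B); split; first by case.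
    by apply/eqP; rewrite -leqn0 rank_leq_row.
  - by move=> k /asboolP; apply: full_ub.
  by exists k => // k' fk'; apply/kmax/asboolP.
have [n [G [G_bohr G_rank]]] := k_full; set M := \matrix_i ev (G i) in G_rank.
have row_in x : bohr_alg x -> (ev x <= M)%MS.
  move=> bx.
  pose G' (i : 'I_(1 + n)) :=
    match fintype.split i with inl _ => x | inr j => G j end.
  have G'E : \matrix_i ev (G' i) = col_mx (ev x) M.
    apply/row_matrixP => i; rewrite rowK /G'; case: split_ordP => j ->.
      by rewrite rowKu (ord1 j) row_id.
    by rewrite rowKd rowK.
  have : (\rank (col_mx (ev x) M) <= \rank M)%N.
    rewrite G_rank; apply: k_max; exists (1 + n)%N, G'; split; last by rewrite G'E.
    by move=> i; rewrite /G'; case: (fintype.split i).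
  rewrite -addsmxE => rk; apply: submx_trans (addsmxSl (ev x) M) _.
  have := mxrank_leqif_sup (addsmxSr (ev x) M) => -[_ <-].
  by rewrite eqn_leq rk mxrankS ?addsmxSr.
have t_in : (t <= M)%MS.
  rewrite submxE; apply/eqP; apply/matrixP => i j; rewrite [RHS]mxE.
  pose c := col j (cokermx M).
  have -> : (t *m cokermx M) i j = (t *m c) i 0 
    by rewrite [LHS]mxE [RHS]mxE; apply: eq_bigr => l _; rewrite [c _ _]mxE.
  rewrite t_rel ?mxE //; apply: bohr_separates => x bx.
  have := row_in x bx; rewrite submxE => /eqP/matrixP/(_ 0 j); rewrite mxE [RHS]mxE => xM.
  rewrite (functional_sum _ _ (scalar_bohr bx)) -[RHS]xM; apply: eq_bigr => l _.
  by rewrite (functionalZ _ _ (scalar_bohr bx)) [c _ _]mxE [ev _ _ _]mxE mulrC.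
have /submxP[D tE] := t_in.
exists (fun b => \sum_i D 0 i * G i b); first exact: bohr_alg_sum.
move=> l; rewrite tE mxE; apply: eq_bigr => i _.
by rewrite !mxE.
Qed.

End Bohr.

(** * Norms on the blocks *)

Section BlockNorm.
Local Open Scope sesquilinear_scope.
Variables (R : realType) (B : hopfStarAlg R).
Hypothesis cqg : is_CQG B.
Local Notation C := R[i].
Local Notation S := (hantipode B).
Local Notation eps := (hcounit B).
Implicit Types (f g x y : B -> C) (D : set B).

Definition modulus (a : C) : R := complex.Re `|a|.

Lemma modulusE a : (modulus a)%:C%C = `|a|.
Proof. by rewrite -realc_ge0. Qed.

Lemma modulus_ge0 a : 0 <= modulus a.
Proof. by rewrite -ler0c modulusE. Qed.

Lemma modulus_eq a r : `|a| = r%:C%C -> modulus a = r.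
Proof. by rewrite /modulus => ->. Qed.

Lemma modulus1 : modulus 1 = 1.
Proof. by apply: modulus_eq; rewrite normr1. Qed.

Lemma modulusN1 : modulus (- 1) = 1.
Proof. by apply: modulus_eq; rewrite normrN1. Qed.

Lemma modulus_nat n : modulus (n%:R : C) = n%:R :> R.
Proof. by apply: modulus_eq; rewrite normr_nat rmorph_nat. Qed.

(** The axioms of [is_block_cstar_norm] with values in [R] throughout and definiteness weakened to
    one implication, so that the zero function satisfies them too. *)
Definition is_block_seminorm D (N : (B -> C) -> R) : Prop :=
  [/\ forall f, scalar f -> 0 <= N f /\ ((forall b, D b -> f b = 0) -> N f = 0),
      forall a f, scalar f -> N (fun b => a * f b) = modulus a * N f,
      forall f g, scalar f -> scalar g -> N (fun b => f b + g b) <= N f + N g,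
      forall f g, scalar f -> scalar g -> N (dmul f g) <= N f * N g &
      forall f, scalar f -> N (dmul (dstar f) f) = N f ^+ 2].

(* If [D] carried no C*-norm, [block_norm D] would be the default value 0. *)
Lemma block_norm_seminorm D : is_block_seminorm D (block_norm D).
Proof.
rewrite /block_norm; case: xgetP => [N _ [N0 NZ ND NM NS]|_]; last first.
  by split=> // *; rewrite ?mulr0 ?addr0 ?expr0n.
split=> // [f lf|a f lf]; first by have [? [_ ?]] := N0 _ lf.
apply: (@complexI R); rewrite NZ // -modulusE.
by rewrite -[RHS]/(real_complex R _) rmorphM.
Qed.

Section Seminorm.
Variables (D : set B) (N : (B -> C) -> R).
Hypothesis N_block : is_block_seminorm D N.

Lemma bnorm_ge0 f : scalar f -> 0 <= N f.
Proof. by have [N0 _ _ _ _] := N_block => /N0[]. Qed.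

Lemma bnorm_dcomb a f g : scalar f -> scalar g ->
  N (dcomb a f g) <= modulus a * N f + N g.
Proof.
have [_ NZ ND _ _] := N_block => lf lg; rewrite -NZ //; apply: (ND (fun b => a * f b)) => //.
by move=> c x y; rewrite lf mulrDr mulrCA.
Qed.

Lemma bnormM f g : scalar f -> scalar g -> N (dmul f g) <= N f * N g.
Proof. by have [_ _ _ NM _] := N_block; apply: NM. Qed.

Lemma bnorm_star_square f : scalar f -> N (dmul (dstar f) f) = N f ^+ 2.
Proof. by have [_ _ _ _ NS] := N_block; apply: NS. Qed.

Lemma bnorm_zero : N (@dzero R B) = 0.
Proof. by have [N0 _ _ _ _] := N_block; apply: (N0 _ (@scalar_dzero R B)).2. Qed.

Lemma bnorm_agree_le f g : scalar f -> scalar g ->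
  (forall b, D b -> f b = g b) -> N f <= N g.
Proof.
move=> lf lg fg; have [N0 _ _ _ _] := N_block.
have lfg : scalar (dcomb (- 1) g f) by exact: scalar_dcomb.
have -> : f = dcomb 1 (dcomb (- 1) g f) g.
  by apply/funext => b; rewrite /dcomb; ring.
apply: le_trans (bnorm_dcomb _ _ _) _ => //.
have [_ ->] := N0 _ lfg; first by rewrite mulr0 add0r.
by move=> b Db; rewrite /dcomb fg //; ring.
Qed.

Lemma bnorm_agree f g : scalar f -> scalar g ->
  (forall b, D b -> f b = g b) -> N f = N g.
Proof.
move=> lf lg fg; apply/le_anti; rewrite !bnorm_agree_le // => b Db.
by rewrite fg.
Qed.

Lemma bnorm_counit : N eps <= 1.
Proof.
(* As [eps] is a self-adjoint idempotent, the C*-identity reads [n = n ^ 2]. *)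
have := bnorm_star_square (@scalar_counit R B).
have N_ge0 := bnorm_ge0 (@scalar_counit R B).
rewrite dstar_counit // dmul1l; last exact: scalar_counit.
set n := N eps in N_ge0 *; move=> nE; rewrite leNgt; apply/negP => n1.
by move: nE; nra.
Qed.

(** The C*-identity and submultiplicativity give [N g ^ 2 <= N (dstar g) * N g]; [dstarK] supplies
    the reverse inequality. *)
Lemma bnorm_dstar f : scalar f -> N (dstar f) = N f.
Proof.
have le g : scalar g -> N g <= N (dstar g).
  move=> lg; have lg' := scalar_dstar lg.
  have := bnormM lg' lg; rewrite bnorm_star_square //.
  have := bnorm_ge0 lg; have := bnorm_ge0 lg'.
  rewrite le_eqVlt => /orP[/eqP <-|]; nra.
move=> lf; apply/le_anti; rewrite le // andbT -{2}(dstarK cqg lf).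
by apply/le/scalar_dstar.
Qed.

Lemma bnorm_sum n (c : 'I_n -> C) (x : 'I_n -> B -> C) : (forall i, scalar (x i)) ->
  scalar (fun b => \sum_i c i * x i b) /\
  N (fun b => \sum_i c i * x i b) <= \sum_i modulus (c i) * N (x i).
Proof.
move=> lx; elim: n c x lx => [|n IHn] c x lx.
  have -> : (fun b => \sum_(k < 0) c k * x k b) = @dzero R B.
    by apply/funext => b; rewrite big_ord0.
  by rewrite big_ord0 bnorm_zero; split=> //; apply: scalar_dzero.
have -> : (fun b => \sum_k c k * x k b) =
    dcomb (c ord0) (x ord0) (fun b => \sum_k c (lift ord0 k) * x (lift ord0 k) b).
  by apply/funext => b; rewrite big_ord_recl.
have [ls Ns] := IHn (fun k => c (lift ord0 k)) (fun k => x (lift ord0 k)) (fun k => lx _).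
split; first exact: scalar_dcomb.
by rewrite big_ord_recl; apply: le_trans (bnorm_dcomb _ _ _) _; rewrite ?lerD2l.
Qed.

Hypotheses (rfd : is_RFD B) (D_coalg : is_matrix_subcoalg D).

(** Interpolation gives functionals [g a] in [bohr_alg] dual to the basis [d] of [D], so [f] agrees
    on [D] with their combination with coefficients [f (d a)]. The constants [K a = N (g a)] do not
    depend on [f], so bounded values on the basis give bounded norms. *)
Lemma bnorm_le_values : exists r (d : 'I_r -> B) (K : 'I_r -> R),
  (forall a, 0 <= K a) /\
  forall f, scalar f -> N f <= \sum_a modulus (f (d a)) * K a.
Proof.
have [n [u [_ cu u_free DE]]] := D_coalg.
pose d (a : 'I_(n * n)) := u (mxtens_unindex a).1 (mxtens_unindex a).2.
have d_free (c : 'cV[C]_(n * n)) : \sum_a c a 0 *: d a = 0 -> c = 0.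
  rewrite sum_mxtens => c0.
  have := u_free (\matrix_(i, j) c (mxtens_index (i, j)) 0).
  have -> // : \sum_i \sum_j (\matrix_(i, j) c (mxtens_index (i, j)) 0) i j *: u i j = 0.
    rewrite -[RHS]c0; apply: eq_bigr => i _; apply: eq_bigr => j _.
    by rewrite /d mxE mxtens_indexK.
  move=> /(_ erefl)/matrixP cE; apply/colP => a; case: (mxtens_indexP a) => i j.
  by have := cE i j; rewrite !mxE.
have /choice[g g_dual] : forall a, exists g, bohr_alg g /\ forall b, g (d b) = (b == a)%:R.
  move=> a; have [|g bg gE] := bohr_interpolation rfd (d := d) (t := delta_mx 0 a).
    by move=> c /d_free ->; rewrite mulmx0.
  by exists g; split=> // b; rewrite gE mxE eqxx.
have lg a : scalar (g a) by have [/scalar_bohr] := g_dual a.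
exists (n * n)%N, d, (fun a => N (g a)); split=> [a|f lf]; first exact: bnorm_ge0.
pose G b := \sum_a f (d a) * g a b.
have [ls Ns] : scalar G /\ N G <= _ := bnorm_sum (fun a => f (d a)) lg.
apply: le_trans Ns; apply: (bnorm_agree_le lf ls) => b; rewrite DE => -[k [c [x [xu ->]]]].
rewrite (functional_sum _ _ lf) (functional_sum _ _ ls); apply: eq_bigr => l _.
rewrite (functionalZ _ _ lf) (functionalZ _ _ ls); congr (_ * _).
have [i [j ->]] := xu l; set a := mxtens_index (i, j).
have -> : u i j = d a by rewrite /d mxtens_indexK.
rewrite /G (bigD1 a) //= (g_dual a).2 eqxx mulr1 big1 ?addr0 // => e /negPf ea.
by rewrite (g_dual e).2 eq_sym ea mulr0.
Qed.

Definition values_mx n f (u : 'M[B]_n) : 'M[C]_n := \matrix_(i, j) f (u i j).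

Lemma values_dmul n f g (u : 'M[B]_n) : is_comodule_mx u -> scalar f -> scalar g ->
  values_mx (dmul f g) u = values_mx f u *m values_mx g u.
Proof.
move=> cu lf lg; apply/matrixP => i j; rewrite !mxE dmulE //.
by apply: eq_bigr => k _; rewrite !mxE.
Qed.

(* The powers [(x^* x)^(2^k)] take values on [D] bounded independently of [k],
   since they are contractions in every unitary comodule, while their norms are
   [N x ^ (2^(k+1))]. *)
Lemma bnorm_bohr_coef x : bohr_coef x -> N x <= 1.
Proof.
move=> x_coef; have lx := scalar_bohr_coef x_coef.
have [m [pi [p [q [_ pi_star xE]]]]] := x_coef.
pose h k := iter k (fun f => dmul f f) (dmul (dstar x) x).
have hS k : h k.+1 = dmul (h k) (h k) by [].
have lh k : scalar (h k).
  elim: k => [|k IHk]; last exact: scalar_dmul.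
  by apply: scalar_dmul => //; apply: scalar_dstar.
have h_star k : dstar (h k) = h k.
  elim: k => [|k IHk]; rewrite /= dstarM //; first by rewrite dstarK.
    exact: scalar_dstar.
  by rewrite -/(h k) IHk.
(* Since [h k] is self-adjoint, the C*-identity says that squaring it squares its norm. *)
have Nh k : N (h k) = N (h 0%N) ^+ (2 ^ k).
  elim: k => [|k IHk]; first by rewrite expr1.
  by rewrite hS -{1}(h_star k) bnorm_star_square // IHk -exprM expnSr.
have h_contr k n (u : 'M[B]_n) :
    is_unitary_comodule_mx u -> contractive_mx (values_mx (h k) u).
  move=> uu; have [cu _ _] := uu; elim: k => [|k IHk]; last first.
    by rewrite hS (values_dmul cu (lh k) (lh k)); apply: contractive_mxM.
  have [_ uV Vu] := coef_mx_unitary pi_star uu.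
  have x_contr : contractive_mx (values_mx x u).
    have -> : values_mx x u = \matrix_(i, j) (fun i j => pi (u i j)) i j p q.
      by apply/matrixP => i j; rewrite !mxE xE.
    exact: flatmx_contractive_mx (unitary_contractive_mx Vu).
  (* The block matrix of the adjoints is the conjugate transpose of the unitary one, so the entry to
     read off becomes [q p]. *)
  have xs_contr : contractive_mx (values_mx (dstar x) u).
    have -> : values_mx (dstar x) u =
        \matrix_(i, j) (fun i j => (pi (u j i))^t*) i j q p.
      by apply/matrixP => i j; rewrite !mxE dstarE // xE.
    apply: flatmx_contractive_mx; rewrite -flatmx_adj.
    by apply: unitary_contractive_mx; rewrite trmxCK.
  have -> : values_mx (h 0%N) u = values_mx (dstar x) u *m values_mx x u.
    by apply: values_dmul => //; apply: scalar_dstar.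
  exact: contractive_mxM.
have h_bounded b : exists2 c : R, 0 <= c & forall k, modulus (h k b) <= c.
  move: b; apply: (CQG_ind cqg) => [|a y z [c c0 yc] [e e0 ze]|n u i j uu].
  - by exists 0 => // k; rewrite (functional0 (lh k)) /modulus normr0.
  - exists (modulus a * c + e) => [|k]; first by rewrite addr_ge0 // mulr_ge0 ?modulus_ge0.
    rewrite lh; apply: (@le_trans _ _ (modulus a * modulus (h k y) + modulus (h k z))).
      by rewrite -lecR modulusE rmorphD rmorphM /= !modulusE -normrM ler_normD.
    by rewrite lerD // ler_wpM2l ?modulus_ge0.
  exists 1 => // k; have := contractive_mx_entry i j (h_contr k n u uu).
  by rewrite mxE -modulusE -lecR.
have [r [d [K [K0 N_le]]]] := bnorm_le_values.
have /choice[c c_bnd] : forall a, exists c : R, forall k, modulus (h k (d a)) <= c.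
  by move=> a; have [c _ ?] := h_bounded (d a); exists c.
have Nh1 : N (h 0%N) <= 1.
  apply: (@le1_of_bounded_powers _ _ (\sum_a c a * K a)); first exact: bnorm_ge0.
  move=> k; exists (2 ^ k)%N; first by rewrite ltnW // ltn_expl.
  by rewrite -Nh; apply: le_trans (N_le _ (lh k)) _; apply: ler_sum => a _; rewrite ler_wpM2r.
by move: Nh1; rewrite bnorm_star_square // expr_le1 // bnorm_ge0.
Qed.

End Seminorm.
End BlockNorm.

(** * Bounded approximation *)

Section Approximation.
Variables (R : realType) (B : hopfStarAlg R).
Hypothesis cqg : is_CQG B.
Local Notation C := R[i].
Local Notation eps := (hcounit B).
Local Notation S := (hantipode B).
Implicit Types (f g x y z w : B -> C) (D : set B).

(** The power [(1 + w)^m] in the dual algebra, where [eps] is the unit. *)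
Definition dpow1 w m : B -> C := iter m (dmul (dcomb 1 w eps)) eps.

Lemma dpow1S w m : dpow1 w m.+1 = dmul (dcomb 1 w eps) (dpow1 w m).
Proof. by []. Qed.

Lemma scalar_dcomb1 w : scalar w -> scalar (dcomb 1 w eps).
Proof. by move=> lw; apply: scalar_dcomb => //; apply: scalar_counit. Qed.

Lemma scalar_dpow1 w m : scalar w -> scalar (dpow1 w m).
Proof.
move=> lw; elim: m => [|m IHm]; first exact: scalar_counit.
by rewrite dpow1S; apply: scalar_dmul IHm; apply: scalar_dcomb1.
Qed.

Section Block.
Variables (D : set B) (N : (B -> C) -> R).
Hypothesis N_block : is_block_seminorm D N.

Lemma bnorm_dcomb1 w : scalar w -> N (dcomb 1 w eps) <= N w + 1.
Proof.
move=> lw; apply: le_trans (bnorm_dcomb N_block _ lw (@scalar_counit R B)) _.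
by rewrite modulus1 mul1r lerD2l (bnorm_counit cqg N_block).
Qed.

(** [E] is the part of the binomial expansion of order at least 2. Multiplying by [1 + w] turns it
    into [m w^2 + (1 + w) E], and [m * N w <= 1] keeps the quadratic bound under this recursion. *)
Lemma dpow1_expansion w m : scalar w -> m%:R * N w <= 1 ->
  exists E, [/\ scalar E, dpow1 w m = dcomb m%:R w (dcomb 1 E eps) &
                N E <= (m%:R * N w) ^+ 2].
Proof.
move=> lw; have w0 := bnorm_ge0 N_block lw; elim: m => [|m IHm] mw.
  exists (@dzero R B); split; first exact: scalar_dzero.
    by apply/funext => b; rewrite /dpow1 /= /dcomb /dzero; ring.
  by rewrite (bnorm_zero N_block) mul0r expr0n.
have [|E [lE PE NE]] := IHm.
  by apply: le_trans mw; rewrite ler_wpM2r // ler_nat.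
have lww := scalar_dmul lw lw; have l1w := scalar_dcomb1 lw.
have l1wE := scalar_dmul l1w lE.
exists (dcomb m%:R (dmul w w) (dmul (dcomb 1 w eps) E)); split.
- exact: scalar_dcomb.
- rewrite dpow1S PE !dmul_dcombr dmul1r // [dmul _ w]dmul_dcombl dmul1l //.
  by apply/funext => b; rewrite /dcomb -natr1; ring.
apply: le_trans (bnorm_dcomb N_block _ lww l1wE) _.
rewrite modulus_nat; move: mw; rewrite -natr1.
have m0 : 0 <= m%:R :> R by [].
have Nww := bnormM N_block lw lw.
have E0 := bnorm_ge0 N_block lE.
have N1wE : N (dmul (dcomb 1 w eps) E) <= (N w + 1) * (m%:R * N w) ^+ 2.
  apply: le_trans (bnormM N_block l1w lE) _.
  by apply: ler_pM => //; [apply: (bnorm_ge0 N_block)|apply: bnorm_dcomb1].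
move: Nww N1wE; set a := N (dmul w w); set b := N (dmul _ E).
move: (N w) (m%:R : R) w0 m0 => n k n0 k0 aE bE kn.
apply: (@le_trans _ _ (k * (n * n) + (n + 1) * (k * n) ^+ 2)).
  by rewrite lerD // ler_wpM2l.
have kn1 : k * n <= 1 by nra.
have -> : ((k + 1) * n) ^+ 2 = k * (n * n) + (n + 1) * (k * n) ^+ 2
  + n ^+ 2 + k * n ^+ 2 * (1 - k * n) by ring.
by rewrite -[leRHS]addrA lerDl addr_ge0 ?sqr_ge0 // !mulr_ge0 ?sqr_ge0 // subr_ge0.
Qed.

(* For skew-adjoint [w] one has [(1 + w)^* (1 + w) = 1 - w^2]. *)
Lemma bnorm_dpow1_skew w m : scalar w -> dstar w = dcomb (- 1) w (@dzero R B) ->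
  m%:R * N w ^+ 2 <= 1 -> N (dpow1 w m) <= 2.
Proof.
move=> lw w_skew mw; have w0 := bnorm_ge0 N_block lw.
have l1w := scalar_dcomb1 lw; have lww := scalar_dmul lw lw.
have sq_le : N (dcomb 1 w eps) ^+ 2 <= 1 + N w ^+ 2.
  rewrite -(bnorm_star_square N_block) // dstar_dcomb w_skew dstar_counit //.
  have -> : dmul (dcomb 1^* (dcomb (- 1) w (@dzero R B)) eps) (dcomb 1 w eps) =
      dcomb (- 1) (dmul w w) eps.
    have dmul0 f : dmul (@dzero R B) f = @dzero R B.
      by apply/funext => b; apply: big1 => p _; rewrite mul0r.
    rewrite !dmul_dcombl dmul0 dmul1l // [dmul w (dcomb _ _ _)]dmul_dcombr dmul1r //.
    by apply/funext => b; rewrite /dcomb /dzero conjC1; ring.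
  apply: le_trans (bnorm_dcomb N_block _ lww (@scalar_counit R B)) _.
  rewrite modulusN1 mul1r addrC lerD ?(bnorm_counit cqg N_block) //.
  by rewrite expr2 (bnormM N_block).
have pow_le k : N (dpow1 w k) <= N (dcomb 1 w eps) ^+ k.
  elim: k => [|k IHk]; first by rewrite expr0 (bnorm_counit cqg N_block).
  rewrite dpow1S exprS; apply: le_trans (bnormM N_block l1w (scalar_dpow1 k lw)) _.
  by rewrite ler_wpM2l // (bnorm_ge0 N_block).
have P0 := bnorm_ge0 N_block (scalar_dpow1 m lw).
have n0 := bnorm_ge0 N_block l1w.
(* The square is at most [(1 + N w ^ 2) ^ m], and [3 <= 2 ^ 2]. *)
have : N (dpow1 w m) ^+ 2 <= 3.
  apply: le_trans (expr1D_le3 (sqr_ge0 (N w)) mw).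
  apply: (@le_trans _ _ ((N (dcomb 1 w eps) ^+ m) ^+ 2)).
    by rewrite lerXn2r ?nnegrE ?exprn_ge0.
  by rewrite -exprM mulnC exprM lerXn2r // nnegrE ?addr_ge0 ?sqr_ge0 // ?exprn_ge0.
by nra.
Qed.

End Block.
End Approximation.

(** * Approximation on finitely many blocks with a bound on all blocks *)

Section Density.
Variables (R : realType) (B : hopfStarAlg R).
Hypotheses (cqg : is_CQG B) (rfd : is_RFD B).
Local Notation C := R[i].
Local Notation eps := (hcounit B).
Local Notation S := (hantipode B).
Local Notation dzero := (@dzero R B).
Implicit Types (f g x y z w : B -> C) (D : set B).

Lemma bnorm_scale D N a f : is_block_seminorm D N -> scalar f ->
  N (dcomb a f dzero) = modulus a * N f.
Proof.
move=> [_ NZ _ _ _] lf; rewrite -NZ //; congr N.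
by apply/funext => b; rewrite /dcomb /dzero addr0.
Qed.

(** Each coefficient has norm at most 1 in every block, so the sum of the moduli of the scalars in a
    combination is a bound uniform in [D]. *)
Lemma bohr_alg_bounded x : bohr_alg x ->
  exists2 K : R, 0 <= K & forall D, is_matrix_subcoalg D -> block_norm D x <= K.
Proof.
move=> bx; suff [] : scalar x /\
  exists2 K : R, 0 <= K & forall D, is_matrix_subcoalg D -> block_norm D x <= K by [].
move: x bx; apply: bohr_ind => [|a x y xc [ly [K K0 yK]]].
  split; first exact: scalar_dzero.
  by exists 0 => // D _; rewrite (bnorm_zero (block_norm_seminorm D)).
have lx := scalar_bohr_coef xc; split; first exact: scalar_dcomb.
exists (modulus a * 1 + K) => [|D mD]; first by rewrite addr_ge0 // mulr1 modulus_ge0.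
have N_block := block_norm_seminorm D.
apply: le_trans (bnorm_dcomb N_block a lx ly) _.
by rewrite lerD ?yK // ler_wpM2l ?modulus_ge0 // (bnorm_bohr_coef cqg N_block rfd mD).
Qed.

Lemma bohr_alg_dpow1 w m : bohr_alg w -> bohr_alg (dpow1 w m).
Proof.
move=> bw; elim: m => [|m IHm]; first exact/bohr_alg_coef/bohr_coef_counit.
rewrite dpow1S; apply: bohr_alg_dmul IHm; apply: bohr_alg_dcomb => //.
exact/bohr_alg_coef/bohr_coef_counit.
Qed.

(* [y = ((1 + i d z / m)^m - 1) / (i d)] for [m] large: it approximates
   [(exp (i d z) - 1) / (i d)], a bounded function of [z] close to [z] where
   [z] is small. *)
Lemma bounded_approximation z (d X : R) : bohr_alg z -> dstar z = z ->
  0 < d -> 0 <= X -> d * X <= 1 ->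
  exists y, [/\ bohr_alg y,
    forall D, is_matrix_subcoalg D -> block_norm D y <= 3 / d &
    forall D, is_matrix_subcoalg D -> block_norm D z <= X ->
      block_norm D (dsub z y) <= d * X ^+ 2].
Proof.
move=> bz z_self d0 X0 dX; have lz := scalar_bohr bz.
have [K K0 zK] := bohr_alg_bounded bz.
(* This makes [m * N w ^ 2 = (d * N z) ^ 2 / m] at most 1 in every block, as [bnorm_dpow1_skew]
   requires. *)
pose m := (Num.truncn ((d * K) ^+ 2)).+1.
have m0 : 0 < m%:R :> R by rewrite ltr0n.
have mK : (d * K) ^+ 2 <= m%:R by rewrite ltW // truncnS_gt.
pose a : C := 'i * (d / m%:R)%:C%C; pose w := dcomb a z dzero.
have a_mod : modulus a = d / m%:R.
  apply: modulus_eq; rewrite normrM normCi mul1r ger0_norm //.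
  by rewrite ler0c divr_ge0 // ltW.
have bw : bohr_alg w by apply: bohr_alg_dcomb => //; apply: bohr_alg_zero.
have lw := scalar_bohr bw.
have a_conj : a^* = - a.
  rewrite /a rmorphM /= conjCi mulNr; congr (- (_ * _)).
  by rewrite conj_Creal // ger0_real // ler0c divr_ge0 // ltW.
have w_skew : dstar w = dcomb (- 1) w dzero.
  rewrite dstar_dcomb z_self a_conj; apply/funext => b.
  by rewrite /w /dcomb /dstar /dzero conjC0; ring.
have Nw D : block_norm D w = d / m%:R * block_norm D z.
  by rewrite (bnorm_scale _ (block_norm_seminorm D)) // a_mod.
pose c : C := 'i * d%:C%C.
have c_mod : modulus c^-1 = d^-1.
  apply: modulus_eq; rewrite normfV normrM normCi mul1r ger0_norm.
    by rewrite fmorphV.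
  by rewrite ler0c ltW.
have c0 : c != 0.
  by rewrite mulf_neq0 ?neq0Ci // (fmorph_eq0 (real_complex R)) gt_eqF.
have am : m%:R * a = c.
  rewrite /a /c rmorphM fmorphV rmorph_nat; field.
  by rewrite pnatr_eq0.
pose y := dcomb c^-1 (dcomb (- 1) eps (dpow1 w m)) dzero.
have lP : scalar (dpow1 w m) := scalar_dpow1 m lw.
have lu : scalar (dcomb (- 1) eps (dpow1 w m)).
  by apply: scalar_dcomb => //; apply: scalar_counit.
exists y; split.
- apply: bohr_alg_dcomb (bohr_alg_zero B); apply: bohr_alg_dcomb.
    exact/bohr_alg_coef/bohr_coef_counit.
  exact: bohr_alg_dpow1.
- move=> D mD; have N_block := block_norm_seminorm D.
  rewrite (bnorm_scale _ N_block) // c_mod mulrC.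
  apply: ler_wpM2r; first by rewrite invr_ge0 ltW.
  apply: le_trans (bnorm_dcomb N_block _ (@scalar_counit R B) lP) _.
  have -> : 3 = 1 + 2 :> R by ring.
  rewrite modulusN1 mul1r; apply: lerD; first exact: (bnorm_counit cqg N_block).
  apply: (bnorm_dpow1_skew cqg N_block) => //.
  have z0 := bnorm_ge0 N_block lz.
  have -> : m%:R * block_norm D w ^+ 2 = (d * block_norm D z) ^+ 2 / m%:R.
    by rewrite Nw; field; rewrite gt_eqF.
  rewrite ler_pdivrMr // mul1r; apply: le_trans mK.
  have dzK : d * block_norm D z <= d * K by apply: ler_wpM2l (zK D mD); exact: ltW.
  by rewrite lerXn2r ?nnegrE // mulr_ge0 // ltW.
move=> D mD zX; have N_block := block_norm_seminorm D.
have z0 := bnorm_ge0 N_block lz.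
have mw : m%:R * block_norm D w = d * block_norm D z.
  by rewrite Nw; field; rewrite gt_eqF.
have dz : d * block_norm D z <= d * X by apply: ler_wpM2l zX; exact: ltW.
have [|E [lE PE NE]] := dpow1_expansion cqg N_block (m := m) lw.
  by rewrite mw (le_trans dz).
(* As [m a = c], the linear term of [dpow1 w m] is [c z], so [y = z + c^-1 E]. *)
have -> : dsub z y = dcomb (- c^-1) E dzero.
  apply/funext => b; rewrite /dsub /y PE /w /dcomb /dzero !addr0 mulrA am.
  by field.
rewrite (bnorm_scale _ N_block) // (_ : modulus (- c^-1) = d^-1); last first.
  by rewrite -c_mod /modulus normrN.
have -> : d * X ^+ 2 = d^-1 * (d * X) ^+ 2 by field; rewrite gt_eqF.
apply: ler_wpM2l; first by rewrite invr_ge0 ltW.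
by apply: le_trans NE _; rewrite mw lerXn2r ?nnegrE // mulr_ge0 // ltW.
Qed.

(** The entries of the comodule matrices that span the blocks in [F] serve as [s]. *)
Lemma finite_determining (F : seq (set B)) :
  (forall D, D \in F -> is_matrix_subcoalg D) ->
  exists s : seq B, forall f g, scalar f -> scalar g ->
    (forall b, b \in s -> f b = g b) -> forall D, D \in F -> forall b, D b -> f b = g b.
Proof.
elim: F => [|D F IHF] mF; first by exists [::].
have [|s s_det] := IHF; first by move=> E EF; apply: mF; rewrite inE EF orbT.
have [|n [u [_ _ _ DE]]] := mF D; first by rewrite inE eqxx.
exists ([seq u ij.1 ij.2 | ij <- enum {: 'I_n * 'I_n}] ++ s) => f g lf lg fg E.
rewrite inE => /orP[/eqP ->|EF]; last first.
  by apply: (s_det f g lf lg _ E EF) => b bs; apply: fg; rewrite mem_cat bs orbT.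
move=> b; rewrite DE => -[k [c [x [xu ->]]]].
rewrite (functional_sum _ _ lf) (functional_sum _ _ lg); apply: eq_bigr => l _.
rewrite (functionalZ _ _ lf) (functionalZ _ _ lg); congr (_ * _).
have [i [j ->]] := xu l; apply: fg; rewrite mem_cat; apply/orP; left.
by apply/mapP; exists (i, j) => //; rewrite mem_enum.
Qed.

(* Interpolating also at the points [(S b)^*] makes the adjoint of the
   interpolant agree with [x^* = x] on [s]. *)
Lemma selfadjoint_interpolation x (s : seq B) : scalar x -> dstar x = x ->
  exists z, [/\ bohr_alg z, dstar z = z & forall b, b \in s -> z b = x b].
Proof.
move=> lx x_self; pose s' := s ++ [seq hstar (S b) | b <- s].
pose d (l : 'I_(size s')) := nth 0 s' l.
have [|z0 bz0 z0E] := bohr_interpolation rfd (d := d) (t := \row_l x (d l)).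
  move=> c c0; apply/matrixP => i j; rewrite !ord1 !mxE.
  rewrite -[RHS](functional0 lx) -c0 (functional_sum _ _ lx); apply: eq_bigr => l _.
  by rewrite (functionalZ _ _ lx) mxE mulrC.
have z0x b : b \in s' -> z0 b = x b.
  rewrite -index_mem => lt_b; have := z0E (Ordinal lt_b).
  by rewrite mxE /d /= nth_index // -index_mem.
have lz0 := scalar_bohr bz0.
pose z := dcomb 2^-1 z0 (dcomb 2^-1 (dstar z0) dzero).
have half : (2^-1 : C)^* = 2^-1 by rewrite conj_Creal // ger0_real // invr_ge0 ler0n.
exists z; split.
- do 2!apply: bohr_alg_dcomb => //; last exact: bohr_alg_zero.
  exact: bohr_alg_dstar.
- rewrite !dstar_dcomb half dstarK //; apply/funext => b.
  by rewrite /z /dcomb {2}/dstar /dzero conjC0; ring.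
move=> b bs; rewrite /z /dcomb /dzero addr0 z0x ?mem_cat ?bs //.
have -> : dstar z0 b = x b.
  rewrite -[in RHS]x_self /dstar z0x // mem_cat; apply/orP; right.
  by apply/mapP; exists b.
by field.
Qed.

(** The interpolant [z] agrees with [x] on the blocks of [F], so its norm there is at most [X], and
    [bounded_approximation] applies. The bound [3 / d] depends neither on [F] nor on [z]. *)
Lemma selfadjoint_density x (d X : R) (F : seq (set B)) : scalar x -> dstar x = x ->
  (forall D, D \in F -> is_matrix_subcoalg D) ->
  (forall D, is_matrix_subcoalg D -> block_norm D x <= X) ->
  0 < d -> 0 <= X -> d * X <= 1 ->
  exists y, [/\ bohr_alg y,
    forall D, is_matrix_subcoalg D -> block_norm D y <= 3 / d &
    forall D, D \in F -> block_norm D (dsub x y) <= d * X ^+ 2].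
Proof.
move=> lx x_self mF xX d0 X0 dX; have [s s_det] := finite_determining mF.
have [z [bz z_self zx]] := selfadjoint_interpolation s lx x_self.
have lz := scalar_bohr bz.
have [y [by' y_bnd zy]] := bounded_approximation bz z_self d0 X0 dX.
have ly := scalar_bohr by'.
exists y; split=> // D DF; have N_block := block_norm_seminorm D.
have zxD := s_det z x lz lx zx D DF.
have lsub f : scalar f -> scalar (dsub f y) by move=> lf c a b; rewrite /dsub lf ly; ring.
have <- : block_norm D (dsub z y) = block_norm D (dsub x y).
  by apply: (bnorm_agree N_block) => [||b /zxD]; [exact: lsub|exact: lsub|rewrite /dsub => ->].
apply: zy (mF D DF) _; rewrite (bnorm_agree N_block lz lx zxD).
exact: xX (mF D DF).
Qed.

Lemma mnorm_lt f (r e : R) : (forall D, is_matrix_subcoalg D -> block_norm D f <= r) ->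
  r < e -> (mnorm f < e%:E)%E.
Proof.
move=> f_le re; apply: (@le_lt_trans _ _ r%:E); last by rewrite lte_fin.
by apply: ge_ereal_sup => _ [D mD <-]; rewrite lee_fin f_le.
Qed.

Lemma mnorm_finite f : (mnorm f < +oo)%E ->
  exists2 X : R, 0 <= X & forall D, is_matrix_subcoalg D -> block_norm D f <= X.
Proof.
have ub D : is_matrix_subcoalg D -> ((block_norm D f)%:E <= mnorm f)%E.
  by move=> mD; apply: ereal_sup_ubound; exists D.
(* The value [-oo] arises only when there is no block, so any bound will do. *)
case: (mnorm f) ub => [r||] // ub _; [exists `|r| => // D mD|exists 0 => // D mD].
  by apply: le_trans (ler_norm r); rewrite -lee_fin; apply: ub.
by have := ub D mD.
Qed.

(** Only finitely many blocks carry norm at least 1; the sum of these norms is added to 1. *)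
Lemma fun_alg_bounded f : fun_alg f ->
  exists2 A : R, 0 <= A & forall D, is_matrix_subcoalg D -> block_norm D f <= A.
Proof.
move=> [lf /(_ 1 ltr01)/finite_seqP[s sE]].
have N_ge0 D : 0 <= block_norm D f := bnorm_ge0 (block_norm_seminorm D) lf.
have sum_ge0 : 0 <= \sum_(D <- s) block_norm D f by apply: sumr_ge0.
exists (1 + \sum_(D <- s) block_norm D f) => [|D mD]; first exact: addr_ge0.
have [lt1|ge1] := ltP (block_norm D f) 1; first by rewrite (le_trans (ltW lt1)) // lerDl.
have Ds : D \in s by have : [set` s] D by rewrite -sE.
rewrite (big_rem D Ds) /= addrCA lerDl addr_ge0 //; exact: sumr_ge0.
Qed.

Lemma bohr_alg_cstar y : bohr_alg y -> bohr_cstar_alg y.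
Proof.
move=> by'; have ly := scalar_bohr by'; split.
  split=> //; have [K _ yK] := bohr_alg_bounded by'.
  have K1 : K < K + 1 by rewrite ltrDl.
  by apply: lt_trans (mnorm_lt yK K1) _; rewrite ltry.
move=> e e0; exists y; split=> //; apply: mnorm_lt e0 => D _.
rewrite (_ : dsub y y = dzero) ?(bnorm_zero (block_norm_seminorm D)) //.
by apply/funext => b; rewrite /dsub subrr.
Qed.

Lemma scalar_dsub f g : scalar f -> scalar g -> scalar (dsub f g).
Proof. by move=> lf lg c a b; rewrite /dsub lf lg; ring. Qed.

Lemma bnorm_dsub D N f g : is_block_seminorm D N -> scalar f -> scalar g ->
  N (dsub f g) <= N f + N g.
Proof.
move=> N_block lf lg; rewrite (_ : dsub f g = dcomb (- 1) g f); last first.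
  by apply/funext => b; rewrite /dsub /dcomb; ring.
by apply: le_trans (bnorm_dcomb N_block _ lg lf) _; rewrite modulusN1 mul1r addrC.
Qed.

Lemma cartesian_decomposition x (X : R) : scalar x ->
  (forall D, is_matrix_subcoalg D -> block_norm D x <= X) ->
  exists x1 x2, [/\ scalar x1 /\ scalar x2, dstar x1 = x1 /\ dstar x2 = x2,
    x = dcomb 'i x2 x1 &
    forall D, is_matrix_subcoalg D -> block_norm D x1 <= X /\ block_norm D x2 <= X].
Proof.
move=> lx xX; have lx' := scalar_dstar lx.
(* The pairs [1/2, 1/2] and [-i/2, i/2] give the real and the imaginary part of [x]. *)
pose part (c c' : C) := dcomb c x (dcomb c' (dstar x) dzero).
have part_scalar c c' : scalar (part c c').
  by do 2!apply: scalar_dcomb => //; apply: scalar_dzero.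
have part_star c c' : dstar (part c c') = part c'^* c^*.
  rewrite !dstar_dcomb dstarK //; apply/funext => b.
  by rewrite /part /dcomb {2}/dstar /dzero conjC0; ring.
have part_le c c' D : `|c| = 2^-1 -> `|c'| = 2^-1 -> is_matrix_subcoalg D ->
    block_norm D (part c c') <= X.
  move=> c1 c1' mD; have N_block := block_norm_seminorm D.
  have half (k : C) : `|k| = 2^-1 -> modulus k = 2^-1.
    by move=> kE; apply: modulus_eq; rewrite kE fmorphV rmorph_nat.
  apply: le_trans (bnorm_dcomb N_block _ lx _) _.
    by apply: scalar_dcomb => //; apply: scalar_dzero.
  rewrite (bnorm_scale _ N_block) // !half // (bnorm_dstar cqg N_block) //.
  by have := xX D mD; set t := block_norm D x; lra.
have i2 : (2^-1 : C)^* = 2^-1 by rewrite conj_Creal // ger0_real // invr_ge0 ler0n.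
have n2 : `|2^-1 : C| = 2^-1 by rewrite ger0_norm // invr_ge0 ler0n.
have ii : 'i * 'i = - 1 :> C by rewrite -expr2 sqrCi.
pose c : C := - ('i / 2).
have c_conj : c^* = - c by rewrite /c rmorphN rmorphM /= conjCi i2; ring.
have c_norm : `|c| = 2^-1 by rewrite normrN normrM normCi mul1r.
exists (part 2^-1 2^-1), (part c (- c)); split.
- by split.
- by rewrite !part_star rmorphN /= c_conj opprK i2.
- apply/funext => b; rewrite /part /dcomb /dzero !addr0 /c.
  have -> : 'i * (- ('i / 2) * x b + - - ('i / 2) * dstar x b) =
    - ('i * 'i) * (x b - dstar x b) / 2 :> C by field.
  by rewrite ii; field.
have cN_norm : `|- c| = 2^-1 by rewrite normrN.
by move=> D mD; split; apply: part_le.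
Qed.

End Density.

(** * The choice of constants and the estimate in the strict topology *)

Theorem proposition3p15 (R : realType) (B : hopfStarAlg R) :
  is_CQG B -> is_RFD B -> dual_maximal_almost_periodic B.
Proof.
move=> cqg rfd x [lx /mnorm_finite[X X0 xX]] n a e a_fun e0.
have [x1 [x2 [[lx1 lx2] [x1_self x2_self] xE x12X]]] := cartesian_decomposition cqg lx xX.
have /choice[Ai Ai_bnd] : forall i, exists A : R, 0 <= A /\
    forall D, is_matrix_subcoalg D -> block_norm D (a i) <= A.
  by move=> i; have [A A0 aA] := fun_alg_bounded (a_fun i); exists A.
pose A := \sum_i Ai i.
have aA i D : is_matrix_subcoalg D -> block_norm D (a i) <= A.
  move=> mD; apply: le_trans ((Ai_bnd i).2 D mD) _.
  by rewrite /A (bigD1 i) //= lerDl sumr_ge0 // => j _; case: (Ai_bnd j).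
have A0 : 0 <= A by apply: sumr_ge0 => i _; case: (Ai_bnd i).
(* The inverse of [d] dominates [X], which gives [dX], and [4 X^2 A / e], which gives [dXA]; the
   summand 1 keeps it positive. *)
pose d := (X + 1 + 4 * X ^+ 2 * A / e)^-1.
have s0 : 0 <= 4 * X ^+ 2 * A / e by rewrite divr_ge0 ?mulr_ge0 ?sqr_ge0 // ltW.
have q0 : 0 < X + 1 + 4 * X ^+ 2 * A / e by rewrite ltr_pwDl // ltr_wpDl.
have d0 : 0 < d by rewrite invr_gt0.
have dX : d * X <= 1.
  by rewrite mulrC ler_pdivrMr // mul1r -addrA lerDl addr_ge0.
have dXA : (2 * (d * X ^+ 2)) * A <= e / 2.
  have key (q : R) : 0 < q -> 2 * (q^-1 * X ^+ 2) * A = (4 * X ^+ 2 * A / e) / q * (e / 2).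
    by move=> q1; field; rewrite !gt_eqF.
  rewrite /d key //; apply: ler_piMl; first by rewrite divr_ge0 // ltW.
  by rewrite ler_pdivrMr // mul1r lerDr addr_ge0.
(* A bound for [dsub x y] in every block: each self-adjoint part contributes at most [X + 3 / d]. It
   is fixed before any blocks are selected, so [eta] and then [F] may depend on it. *)
pose Q := 2 * (X + 3 / d).
have Q0 : 0 <= Q by rewrite mulr_ge0 // addr_ge0 // divr_ge0 // ltW.
pose eta := e / 2 / (Q + 1).
have eta0 : 0 < eta by rewrite !divr_gt0 // ltr_wpDl.
have [F FE] : exists F : seq (set B), forall D, D \in F <->
    is_matrix_subcoalg D /\ exists i, eta <= block_norm D (a i).
  have /finite_seqP[F FE] : finite_set (\bigcup_(i in [set: 'I_n])
      [set D | is_matrix_subcoalg D /\ eta <= block_norm D (a i)]).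
    by apply: bigcup_finite => // i _; have [_ /(_ _ eta0)] := a_fun i.
  exists F => D; have -> : (D \in F) = [set` F] D :> Prop by [].
  rewrite -FE; split=> [[i _ [mD Di]]|[mD [i Di]]]; first by split=> //; exists i.
  by exists i.
have mF D : D \in F -> is_matrix_subcoalg D by move=> /FE[].
have [y1 [by1 y1_bnd xy1]] := selfadjoint_density cqg rfd lx1 x1_self mF
  (fun D mD => (x12X D mD).1) d0 X0 dX.
have [y2 [by2 y2_bnd xy2]] := selfadjoint_density cqg rfd lx2 x2_self mF
  (fun D mD => (x12X D mD).2) d0 X0 dX.
have [ly1 ly2] := (scalar_bohr by1, scalar_bohr by2).
pose y := dcomb 'i y2 y1.
have bohr_y : bohr_alg y by apply: bohr_alg_dcomb.
have lxy : scalar (dsub x y) := scalar_dsub lx (scalar_bohr bohr_y).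
have small i D : is_matrix_subcoalg D -> block_norm D (dsub x y) * block_norm D (a i) <= e / 2.
  move=> mD; have N_block := block_norm_seminorm D.
  have [la _] := a_fun i.
  have xy_le : block_norm D (dsub x y) <=
      block_norm D (dsub x2 y2) + block_norm D (dsub x1 y1).
    have -> : dsub x y = dcomb 'i (dsub x2 y2) (dsub x1 y1).
      by rewrite xE; apply/funext => b; rewrite /y /dsub /dcomb; ring.
    apply: le_trans (bnorm_dcomb N_block _ _ _) _; try exact: scalar_dsub.
    by rewrite (modulus_eq (r := 1)) ?normCi // mul1r.
  have xy0 := bnorm_ge0 N_block lxy; have a0 := bnorm_ge0 N_block la.
  (* On [F] the difference is small and [a i] is bounded by [A]; off [F] the difference is bounded
     by [Q] and [a i] is below [eta]. *)
  have [DF|DF] := boolP (D \in F).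
    apply: le_trans dXA; apply: ler_pM => //; last exact: aA.
    apply: le_trans xy_le _; have := xy1 D DF; have := xy2 D DF.
    by set t := d * X ^+ 2; lra.
  have a_lt : block_norm D (a i) < eta.
    rewrite ltNge; apply/negP => ge_eta; move/negP: DF; apply; apply/FE.
    by split=> //; exists i.
  apply: (@le_trans _ _ (Q * eta)).
    apply: ler_pM => //; last exact: ltW.
    apply: le_trans xy_le _; have [X1 X2] := x12X D mD.
    have := bnorm_dsub N_block lx1 ly1; have := bnorm_dsub N_block lx2 ly2.
    have := y1_bnd D mD; have := y2_bnd D mD.
    by rewrite /Q; set t := 3 / d; lra.
  rewrite /eta mulrCA ler_piMr ?divr_ge0 ?(ltW e0) //.
  by rewrite ler_pdivrMr ?mul1r ?lerDl // ltr_wpDl.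
have e2 : e / 2 < e by rewrite ltr_pdivrMr // ltr_pMr // ltr1n.
exists y; split=> [|i]; first exact: bohr_alg_cstar.
have [la _] := a_fun i.
split; apply: mnorm_lt e2 => D mD; apply: le_trans (small i D mD).
  exact: (bnormM (block_norm_seminorm D) lxy la).
by rewrite [leRHS]mulrC; apply: (bnormM (block_norm_seminorm D) la lxy).
Qed.
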